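(* Let $\gamma\in\mathrm{PSL}(n+1,\mathbb{H})$ be a loxoparabolic transformation having a lift in $\mathrm{SL}(n+1,\mathbb{H})$ of the block diagonal form $$\begin{bmatrix}\lambda_1A_1&&\\&\ddots&\\&&\lambda_kA_k\end{bmatrix},\qquad |\lambda_1|<|\lambda_2|<\cdots<|\lambda_k|,$$ where each $\lambda_i$ is a nonzero complex number and each $A_i$ is a parabolic block of size $m_i\times m_i$, $i=1,\dots,k$. Let $\Gamma=\langle\gamma\rangle$. For $i=1,\dots,k$ let $V_i=L\{e_{m_1+\cdots+m_{i-1}+1},\dots,e_{m_1+\cdots+m_i}\}\cong\mathbb{P}^{m_i-1}_{\mathbb{H}}$, let $\mathrm{Eq}(A_i)\subseteq V_i$ be the equicontinuity region of the cyclic group generated by $A_i$ acting on $V_i$, and let $\mathrm{Eq}(A_i)^c=V_i\setminus\mathrm{Eq}(A_i)$. Then $$\mathrm{Eq}(\Gamma)=\mathbb{P}^n_{\mathbb{H}}\setminus\Big(L\big\{\mathrm{Eq}(A_1)^c,\,e_{m_1+1},\dots,e_{n+1}\big\}\ \cup\ L\big\{e_1,\dots,e_{m_1+\cdots+m_{k-1}},\,\mathrm{Eq}(A_k)^c\big\}\Big).$$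
   Context: $\mathbb{H}$ is the division ring of quaternions; $\mathbb{H}^{n+1}$ is a right $\mathbb{H}$-vector space and $\mathbb{P}^n_{\mathbb{H}}=(\mathbb{H}^{n+1}\setminus\{0\})/\sim$, where $z\sim w$ iff $z=w\alpha$ for some $\alpha\in\mathbb{H}\setminus\{0\}$. $e_1,\dots,e_{n+1}$ denote the points of $\mathbb{P}^n_{\mathbb{H}}$ given by the standard basis vectors, and $L\{\cdots\}$ is the smallest projective subspace (projectivization of an $\mathbb{H}$-linear subspace) containing the listed points and sets. Writing a quaternionic matrix as $A=A_1+A_2 j$ with $A_1,A_2$ complex, $\det_{\mathbb{H}}(A)=\det\begin{bmatrix}A_1&A_2\\-\overline{A_2}&\overline{A_1}\end{bmatrix}$; $\mathrm{SL}(n+1,\mathbb{H})=\{g:\det_{\mathbb{H}}(g)=1\}$, $\mathrm{PSL}(n+1,\mathbb{H})=\mathrm{SL}(n+1,\mathbb{H})/\{\pm I\}$, acting on $\mathbb{P}^n_{\mathbb{H}}$ via the linear action on $\mathbb{H}^{n+1}$. An element of $\mathrm{PSL}$ is loxoparabolic if it is not semisimple (lifts not diagonalizable over $\mathbb{H}$) and at least one (right) eigenvalue has modulus $\ne1$ (so here necessarily $k\ge 2$). A parabolic block is a matrix in quaternionic Jordan form, i.e. a direct sum of Jordan blocks $\mathrm{J}(\mu,r)$ ($r\times r$, $\mu$ on the diagonal, $1$ on the superdiagonal, $\mu$ complex with non-negative imaginary part), which is not diagonalizable and all of whose eigenvalues have modulus $1$. A family of maps from a topological space into a quaternionic projective space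 is normal if every sequence in it has a subsequence converging uniformly on compact subsets. For a group $G$ of projective transformations of $\mathbb{P}^r_{\mathbb{H}}$, $\mathrm{Eq}(G)$ is the set of $z\in\mathbb{P}^r_{\mathbb{H}}$ having an open neighborhood $U$ such that $\{g|_U: g\in G\}$ is normal. *)

(* Defs.v *)
From HB Require Import structures.
From mathcomp Require Import all_boot all_order all_algebra.
From mathcomp Require Import complex ring lra.
From mathcomp Require Import all_classical all_reals all_analysis.

Set Implicit Arguments.
Unset Strict Implicit.
Unset Printing Implicit Defensive.

Import Order.TTheory GRing.Theory Num.Theory ComplexField.
Import numFieldNormedType.Exports.

Local Open Scope classical_set_scope.
Local Open Scope quotient_scope.
Local Open Scope ring_scope.

(* [Quat a b] is a + b j, with j^2 = -1 and j c = conj(c) j for c complex. *)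
Record quat (R : realType) : Type := Quat { qa : R[i]; qb : R[i] }.

Section Quaternions.
Variable R : realType.
Local Notation C := R[i].
Local Notation H := (quat R).
Implicit Types p q r : H.

Definition quat_pair q : C * C := (qa q, qb q).
Definition pair_quat (x : C * C) : H := Quat x.1 x.2.
Lemma quat_pairK : cancel quat_pair pair_quat.
Proof. by case. Qed.
HB.instance Definition _ := Choice.copy H (can_type quat_pairK).

Definition addq p q : H := Quat (qa p + qa q) (qb p + qb q).
Definition oppq p : H := Quat (- qa p) (- qb p).
Definition mulq p q : H :=
  Quat (qa p * qa q - qb p * conjc (qb q)) (qa p * qb q + qb p * conjc (qa q)).

Lemma addqA : associative addq.
Proof. by move=> p q r; rewrite /addq /= !addrA. Qed.
Lemma addqC : commutative addq.
Proof. by move=> p q; rewrite /addq addrC [qb p + _]addrC. Qed.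
Lemma add0q : left_id (Quat 0 0) addq.
Proof. by case=> a b; rewrite /addq /= !add0r. Qed.
Lemma addNq : left_inverse (Quat 0 0) oppq addq.
Proof. by move=> p; rewrite /addq /= !addNr. Qed.
HB.instance Definition _ := GRing.isZmodule.Build H addqA addqC add0q addNq.

Lemma mulqA : associative mulq.
Proof.
move=> [a b] [c d] [e f]; rewrite /mulq /=.
rewrite !(rmorphB, rmorphD, rmorphM) /= !conjcK.
by congr Quat; ring.
Qed.
Lemma mul1q : left_id (Quat 1 0) mulq.
Proof. by case=> a b; rewrite /mulq /= !mul0r subr0 addr0 !mul1r. Qed.
Lemma mulq1 : right_id (Quat 1 0) mulq.
Proof.
case=> a b; have := (rmorph0 (@conjc R), rmorph1 (@conjc R)); rewrite /mulq => c01.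
by cbn [qa qb]; rewrite !c01 !mulr0 subr0 add0r !mulr1.
Qed.
Lemma mulqDl : left_distributive mulq +%R.
Proof. by move=> p q r; congr Quat; rewrite /=; ring. Qed.
Lemma mulqDr : right_distributive mulq +%R.
Proof.
by move=> p q r; congr Quat; rewrite /= !rmorphD; ring.
Qed.
Lemma oneq_neq0 : Quat 1 0 != 0 :> H.
Proof. by apply/eqP => -[/eqP]; rewrite oner_eq0. Qed.
HB.instance Definition _ :=
  GRing.Zmodule_isNzRing.Build H mulqA mul1q mulq1 mulqDl mulqDr oneq_neq0.

Definition qcplx (c : C) : H := Quat c 0.
Definition qreal (x : R) : H := qcplx (x%:C)%C.
Definition qconj q : H := Quat (conjc (qa q)) (- qb q).
Definition qnormsq q : R :=
  complex.Re (qa q) ^+ 2 + complex.Im (qa q) ^+ 2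
  + complex.Re (qb q) ^+ 2 + complex.Im (qb q) ^+ 2.
Definition qnorm q : R := Num.sqrt (qnormsq q).

Lemma qnormsq_ge0 q : 0 <= qnormsq q.
Proof. by rewrite !addr_ge0 ?sqr_ge0. Qed.

Lemma qnormsq_eq0 q : (qnormsq q == 0) = (q == 0).
Proof.
case: q => [[a b] [c d]]; rewrite /qnormsq /=.
rewrite !paddr_eq0 ?addr_ge0 ?sqr_ge0 // !sqrf_eq0.
apply/idP/eqP => [/andP[/andP[/andP[/eqP-> /eqP->] /eqP->] /eqP->]//|].
by case=> -> -> -> ->; rewrite !eqxx.
Qed.

Lemma mulqconj q : q * qconj q = qreal (qnormsq q).
Proof.
case: q => [[a b] [c d]].
apply/eqP; rewrite -subr_eq0 -qnormsq_eq0 /qnormsq /=.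
by apply/eqP; ring.
Qed.

Lemma mulconjq q : qconj q * q = qreal (qnormsq q).
Proof.
case: q => [[a b] [c d]].
apply/eqP; rewrite -subr_eq0 -qnormsq_eq0 /qnormsq /=.
by apply/eqP; ring.
Qed.

Lemma qreal_comm x q : qreal x * q = q * qreal x.
Proof.
case: q => [[a b] [c d]].
apply/eqP; rewrite -subr_eq0 -qnormsq_eq0 /qnormsq /=.
by apply/eqP; ring.
Qed.

Lemma qrealM x y : qreal (x * y) = qreal x * qreal y.
Proof.
apply/eqP; rewrite -subr_eq0 -qnormsq_eq0 /qnormsq /=.
by apply/eqP; ring.
Qed.

Lemma qrealD x y : qreal (x + y) = qreal x + qreal y.
Proof.
apply/eqP; rewrite -subr_eq0 -qnormsq_eq0 /qnormsq /=.
by apply/eqP; ring.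
Qed.

Lemma qreal1 : qreal 1 = 1. Proof. by []. Qed.
Lemma qreal0 : qreal 0 = 0. Proof. by []. Qed.

Definition qinv q : H := if q == 0 then q else qconj q * qreal (qnormsq q)^-1.

Lemma mulVq : {in [pred q | q != 0], left_inverse 1 qinv *%R}.
Proof.
move=> q; rewrite inE => q0; rewrite /qinv (negbTE q0) -mulrA qreal_comm mulrA.
by rewrite mulconjq -qrealM divff ?qreal1 // qnormsq_eq0.
Qed.
Lemma mulqV : {in [pred q | q != 0], right_inverse 1 qinv *%R}.
Proof.
move=> q; rewrite inE => q0; rewrite /qinv (negbTE q0) mulrA.
by rewrite mulqconj -qrealM divff ?qreal1 // qnormsq_eq0.
Qed.
Lemma unitqP p q : q * p = 1 /\ p * q = 1 -> p \in [pred q | q != 0].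
Proof.
move=> [qp _]; rewrite inE; apply/eqP => p0.
by move/eqP: qp; rewrite p0 mulr0 eq_sym oner_eq0.
Qed.
Lemma qinv_out : {in [predC [pred q | q != 0]], qinv =1 id}.
Proof. by move=> q; rewrite !inE negbK /qinv => ->. Qed.
HB.instance Definition _ :=
  GRing.NzRing_hasMulInverse.Build H mulVq mulqV unitqP qinv_out.

Lemma qnorm_ge0 q : 0 <= qnorm q. Proof. exact: sqrtr_ge0. Qed.

Lemma qnorm_eq0 q : (qnorm q == 0) = (q == 0).
Proof. by rewrite sqrtr_eq0 -qnormsq_eq0 eq_le qnormsq_ge0 andbT. Qed.

Lemma qnormN q : qnorm (- q) = qnorm q.
Proof.
by case: q => [[a b] [c d]]; rewrite /qnorm /qnormsq /= !sqrrN.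
Qed.

Lemma qnormD p q : qnorm (p + q) <= qnorm p + qnorm q.
Proof.
rewrite -(@ler_pXn2r _ 2) ?nnegrE ?addr_ge0 ?qnorm_ge0 //.
rewrite sqrrD !sqr_sqrtr ?qnormsq_ge0 //.
case: p q => [[a b] [c d]] [[e f] [g h]].
set P := qnormsq (Quat (Complex a b) _); set Q := qnormsq (Quat (Complex e f) _).
have dotle : a * e + b * f + c * g + d * h <= Num.sqrt P * Num.sqrt Q.
  rewrite -sqrtrM ?qnormsq_ge0 //; apply: le_trans (ler_norm _) _.
  rewrite -sqrtr_sqr ler_sqrt ?mulr_ge0 ?qnormsq_ge0 // -subr_ge0.
  have -> : P * Q - (a * e + b * f + c * g + d * h) ^+ 2 =
    (a * f - b * e) ^+ 2 + (a * g - c * e) ^+ 2 + (a * h - d * e) ^+ 2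
    + (b * g - c * f) ^+ 2 + (b * h - d * f) ^+ 2 + (c * h - d * g) ^+ 2.
    by rewrite /P /Q /qnormsq /=; ring.
  by rewrite !addr_ge0 ?sqr_ge0.
rewrite [qnormsq (_ + _)](_ : _ =
  P + (a * e + b * f + c * g + d * h) *+ 2 + Q); last first.
  by rewrite /P /Q /qnormsq /=; ring.
by rewrite lerD2r lerD2l lerMn2r dotle orbT.
Qed.

End Quaternions.

Section ProjectiveSpace.
Variable (R : realType) (N : nat).
Local Notation H := (quat R).

Definition nzvec := {v : 'cV[H]_N | v != 0}.

(* H^N is a right vector space: [w *m a%:M] is the vector w a. *)
Definition proj_rel (z w : nzvec) : bool :=
  `[< exists2 a : H, a != 0 & val z = val w *m a%:M >].

Lemma proj_rel_refl : reflexive proj_rel.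
Proof. by move=> z; apply/asboolP; exists 1; rewrite ?oner_neq0 ?mulmx1. Qed.

Lemma proj_rel_sym : symmetric proj_rel.
Proof.
suff sub z w : proj_rel z w -> proj_rel w z by move=> z w; apply/idP/idP; apply: sub.
move=> /asboolP[a a0 zw]; apply/asboolP; exists a^-1.
  by apply: contra_neq a0 => a0; rewrite -[a]invrK a0 invr0.
by rewrite zw -mulmxA -scalar_mxM divrr ?mulmx1.
Qed.

Lemma proj_rel_trans : transitive proj_rel.
Proof.
move=> y x z /asboolP[a a0 xy] /asboolP[b b0 yz]; apply/asboolP; exists (b * a).
  apply: contra_neq b0 => ba0.
  by rewrite -[b](mulrK (a0 : a \is a GRing.unit)) ba0 mul0r.
by rewrite xy yz -mulmxA -scalar_mxM.
Qed.

Canonical proj_equiv := EquivRel proj_rel proj_rel_refl proj_rel_sym proj_rel_trans.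

(* The projective space of lines of H^N, of dimension N - 1. *)
Definition proj := {eq_quot proj_equiv}.
HB.instance Definition _ := Choice.on proj.
HB.instance Definition _ := EqQuotient.on proj.

Definition proj_pt (v : nzvec) : proj := \pi_proj v.

Lemma proj_ptP (v w : nzvec) :
  proj_pt v = proj_pt w <-> exists2 a : H, a != 0 & val v = val w *m a%:M.
Proof.
by rewrite /proj_pt; split=> [/eqmodP/asboolP|?]; [|apply/eqmodP/asboolP].
Qed.

Lemma repr_proj_pt (p : proj) : proj_pt (repr p) = p.
Proof. exact: reprK. Qed.

(* Matrix of the orthogonal projector z z^* / |z|^2 onto the line z H; it
   depends only on the class of z, and p |-> projector p embeds the projective
   space in the space of Hermitian matrices. The metric below is induced by this
   embedding, and its topology is the quotient topology (lemma proj_open). *)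
Definition vnormsq (v : 'cV[H]_N) : R := \sum_i qnormsq (v i 0).

Definition projector (p : proj) : 'M[H]_N :=
  let z := val (repr p) in
  \matrix_(i, j) (z i 0 * qconj (z j 0) * qreal (vnormsq z)^-1).

Definition proj_dist (p q : proj) : R :=
  \sum_i \sum_j qnorm (projector p i j - projector q i j).

Lemma vnormsq_ge0 v : 0 <= vnormsq v.
Proof. by apply: sumr_ge0 => i _; apply: qnormsq_ge0. Qed.

Lemma vnormsq_eq0 v : (vnormsq v == 0) = (v == 0).
Proof.
rewrite psumr_eq0; last by move=> i _; apply: qnormsq_ge0.
apply/allP/eqP => [v0|-> i _]; last by rewrite mxE qnormsq_eq0 eqxx.
apply/matrixP => i j; rewrite mxE ord1; apply/eqP.
by rewrite -qnormsq_eq0; apply: v0; rewrite mem_index_enum.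
Qed.

Lemma qreal_sum (I : Type) (r : seq I) (F : I -> R) :
  qreal (\sum_(i <- r) F i) = \sum_(i <- r) qreal (F i).
Proof. by apply: big_morph; [apply: qrealD | apply: qreal0]. Qed.

Lemma projector_id (p : proj) : projector p *m val (repr p) = val (repr p).
Proof.
set z := val (repr p); apply/matrixP => i j; rewrite ord1 mxE.
have z0 : vnormsq z != 0 by rewrite vnormsq_eq0; exact: (valP (repr p)).
under eq_bigr => l _.
  rewrite mxE -/z -mulrA qreal_comm !mulrA -[_ * qconj _ * _]mulrA mulconjq -mulrA.
  over.
rewrite -mulr_sumr -mulr_suml -qreal_sum -qrealM divff // qreal1 mulr1 //.
Qed.

Lemma projector_line (p : proj) (v : 'cV[H]_N) :
  exists a, projector p *m v = val (repr p) *m a%:M.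
Proof.
set z := val (repr p).
exists (\sum_j qconj (z j 0) * qreal (vnormsq z)^-1 * v j 0).
apply/matrixP => i j; rewrite ord1 !mxE big_ord1 mxE eqxx mulr1n mulr_sumr.
by apply: eq_bigr => l _; rewrite mxE -/z !mulrA.
Qed.

Lemma projector_inj : injective projector.
Proof.
move=> p q pq; rewrite -[p]repr_proj_pt -[q]repr_proj_pt; apply/proj_ptP.
have [a za] := projector_line q (val (repr p)).
move: za; rewrite -pq projector_id => za; exists a => //.
apply: contra_eq_neq za => /= ->; rewrite raddf0 mulmx0.
exact: (valP (repr p)).
Qed.

Lemma proj_distxx p : proj_dist p p = 0.
Proof.
by apply: big1 => i _; apply: big1 => j _; apply/eqP; rewrite subrr qnorm_eq0.
Qed.

Lemma proj_dist_positivity p q : proj_dist p q = 0 -> p = q.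
Proof.
move=> /eqP; rewrite psumr_eq0; last first.
  by move=> i _; apply: sumr_ge0 => j _; apply: qnorm_ge0.
move=> /allP d0; apply: projector_inj; apply/matrixP => i j.
have /implyP/(_ isT) := d0 i (mem_index_enum _).
rewrite psumr_eq0; last by move=> l _; apply: qnorm_ge0.
move=> /allP/(_ j (mem_index_enum _))/implyP/(_ isT).
by rewrite qnorm_eq0 subr_eq0 => /eqP.
Qed.

Lemma proj_dist_sym p q : proj_dist p q = proj_dist q p.
Proof.
by apply: eq_bigr => i _; apply: eq_bigr => j _; rewrite -opprB qnormN.
Qed.

Lemma proj_dist_triangle q p r : proj_dist p r <= proj_dist p q + proj_dist q r.
Proof.
rewrite -big_split /=; apply: ler_sum => i _; rewrite -big_split /=.
apply: ler_sum => j _; apply: le_trans (qnormD _ _).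
by rewrite addrA subrK.
Qed.

HB.instance Definition _ := isMetric.Build R proj
  proj_distxx proj_dist_positivity proj_dist_sym proj_dist_triangle.

End ProjectiveSpace.
Arguments proj_pt {R N}.

Section Topology.
Variable (R : realType) (N : nat).
Local Notation H := (quat R).

Lemma qnormsqM (p q : H) : qnormsq (p * q) = qnormsq p * qnormsq q.
Proof. by case: p q => [[a b] [c d]] [[e f] [g h]]; rewrite /qnormsq /=; ring. Qed.

Lemma qnormM (p q : H) : qnorm (p * q) = qnorm p * qnorm q.
Proof. by rewrite /qnorm qnormsqM sqrtrM // qnormsq_ge0. Qed.

Lemma qnorm_conj (p : H) : qnorm (qconj p) = qnorm p.
Proof. by case: p => [[a b] [c d]]; rewrite /qnorm /qnormsq /= !sqrrN. Qed.

Lemma qnorm_real (x : R) : qnorm (qreal x) = `|x|.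
Proof. by rewrite /qnorm /qnormsq /= !expr0n /= !addr0 sqrtr_sqr. Qed.

Lemma sqr_qnorm (p : H) : qnorm p ^+ 2 = qnormsq p.
Proof. by rewrite sqr_sqrtr ?qnormsq_ge0. Qed.

Lemma qnorm0 : qnorm (0 : H) = 0.
Proof. by apply/eqP; rewrite qnorm_eq0. Qed.

Lemma qnorm_sum (I : Type) (r : seq I) (F : I -> H) :
  qnorm (\sum_(i <- r) F i) <= \sum_(i <- r) qnorm (F i).
Proof.
elim/big_rec2: _ => [|i x y _ xy]; first by rewrite qnorm0.
by apply: le_trans (qnormD _ _) _; rewrite lerD2l.
Qed.

Lemma qconjM (p q : H) : qconj (p * q) = qconj q * qconj p.
Proof.
case: p q => [[a b] [c d]] [[e f] [g h]].
apply/eqP; rewrite -subr_eq0 -qnormsq_eq0 /qnormsq /=.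
by apply/eqP; ring.
Qed.

Lemma projectorE (v : nzvec R N) i j : projector (proj_pt v) i j =
  val v i 0 * qconj (val v j 0) * qreal (vnormsq (val v))^-1.
Proof.
rewrite mxE; set z := repr _.
have /proj_ptP[a a0 ->] : proj_pt z = proj_pt v by rewrite repr_proj_pt.
have coordE l : (val v *m a%:M) l 0 = val v l 0 * a.
  by rewrite mxE big_ord1 mxE eqxx mulr1n.
have na0 : qnormsq a != 0 by rewrite qnormsq_eq0.
have -> : vnormsq (val v *m a%:M) = vnormsq (val v) * qnormsq a.
  by rewrite /vnormsq mulr_suml; apply: eq_bigr => l _; rewrite coordE qnormsqM.
rewrite !coordE qconjM !mulrA -[_ * a * qconj a]mulrA mulqconj -[_ * qreal _ * _]mulrA.
rewrite qreal_comm mulrA -mulrA -qrealM; congr (_ * qreal _).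
by rewrite invfM mulrCA divff ?mulr1.
Qed.

Lemma proj_open (U : set (proj R N)) : open U <->
  forall z : nzvec R N, U (proj_pt z) -> exists2 e : R, 0 < e &
  forall w : nzvec R N, (forall i, qnorm (val w i 0 - val z i 0) < e) ->
    U (proj_pt w).
Proof.
rewrite openE; split=> [oU z Uz|oU p Up].
- have /nbhs_ballP[r /= r0 rU] := oU _ Uz.
  pose s := vnormsq (val z).
  have s0 : 0 < s.
    by rewrite lt_neqAle eq_sym vnormsq_eq0 (valP z) vnormsq_ge0.
  pose M := 1 + \sum_i qnorm (val z i 0).
  have M1 : 1 <= M by rewrite lerDl sumr_ge0 // => i _; exact: qnorm_ge0.
  have zM i : qnorm (val z i 0) <= M.
    rewrite /M (bigD1 i) //= addrCA lerDl addr_ge0 ?sumr_ge0 // => l _.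
    exact: qnorm_ge0.
  pose K := 3 * M.
  have K0 : 0 < K by rewrite mulr_gt0 // (lt_le_trans ltr01).
  pose B := N%:R * K.
  have B0 : 0 <= B by rewrite mulr_ge0 ?ler0n ?(ltW K0).
  pose D := N%:R * (N%:R * (2 / s * (K + B))).
  have D0 : 0 <= D.
    rewrite /D !mulr_ge0 ?ler0n ?invr_ge0 ?(ltW s0) //.
    by rewrite addr_ge0 ?(ltW K0).
  pose e := Num.min 1 (Num.min (s / 2 / (B + 1)) (r / (D + 1))).
  have e0 : 0 < e.
    by rewrite !lt_min ltr01 /= !divr_gt0 // ltr_wpDl.
  exists e => // w wz; apply: rU; rewrite /= ballEmdist /=.
  have e1 : e <= 1 by rewrite ge_min lexx.
  have eB : e * B <= s / 2.
    apply: (@le_trans _ _ (s / 2 / (B + 1) * B)).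
      by rewrite ler_wpM2r // !ge_min lexx orbT.
    by rewrite -mulrA ler_piMr ?divr_ge0 ?(ltW s0) // mulrC ler_pdivrMr ?mul1r ?lerDl // ltr_wpDl.
  have eD : e * D < r.
    apply: (@le_lt_trans _ _ (r / (D + 1) * D)).
      by rewrite ler_wpM2r // !ge_min lexx !orbT.
    by rewrite -mulrA gtr_pMr // mulrC ltr_pdivrMr ?mul1r ?ltrDl // ltr_wpDl.
  have wM i : qnorm (val w i 0) <= 2 * M.
    rewrite -[val w i 0](subrK (val z i 0)); apply: le_trans (qnormD _ _) _.
    by have := wz i; have := zM i; lra.
  pose t := vnormsq (val w).
  have st : `|t - s| <= e * B.
    rewrite /t /s /vnormsq -sumrB; apply: le_trans (ler_norm_sum _ _ _) _.
    apply: (@le_trans _ _ (\sum_(i < N) e * K)); last first.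
      by rewrite sumr_const card_ord -(mulr_natl (e * K)) mulrCA.
    apply: ler_sum => i _; rewrite -!sqr_qnorm subr_sqr normrM.
    apply: ler_pM => //.
      apply: le_trans (ltW (wz i)); rewrite ler_norml; apply/andP; split.
        have := qnormD (val w i 0) (val z i 0 - val w i 0).
        by rewrite addrC subrK -opprB qnormN; lra.
      have := qnormD (val z i 0) (val w i 0 - val z i 0).
      by rewrite addrC subrK; lra.
    rewrite ger0_norm ?addr_ge0 ?qnorm_ge0 // /K.
    by have := wM i; have := zM i; lra.
  have t2 : s / 2 <= t.
    by move: st; rewrite ler_norml => /andP[+ _]; lra.
  have t0 : 0 < t by apply: lt_le_trans t2; rewrite divr_gt0.
  have tV : t^-1 <= 2 / s by rewrite -[2 / s]invf_div lef_pV2 ?posrE ?divr_gt0.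
  apply: le_lt_trans eD; rewrite /D.
  rewrite [mdist _ _]/(proj_dist _ _).
  apply: (@le_trans _ _ (\sum_(i < N) \sum_(j < N) e * (2 / s * (K + B)))); last first.
    rewrite !sumr_const !card_ord; move: (2 / s * _) => X.
    by rewrite -mulrnA -(mulr_natl (e * X)) natrM -[N%:R * N%:R * _]mulrA !(mulrCA _ e).
  apply: ler_sum => i _; apply: ler_sum => j _; rewrite !projectorE -/s -/t.
  set a := val w i 0 * _; set b := val z i 0 * _.
  have ab : qnorm (b - a) <= e * K.
    have -> : b - a = (val z i 0 - val w i 0) * qconj (val z j 0)
        + val w i 0 * (qconj (val z j 0) - qconj (val w j 0)).
      by rewrite mulrBl mulrBr addrA subrK.
    apply: le_trans (qnormD _ _) _; rewrite !qnormM.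
    have -> : qconj (val z j 0) - qconj (val w j 0) = qconj (val z j 0 - val w j 0).
      case: (val z j 0) (val w j 0) => [[? ?] [? ?]] [[? ?] [? ?]].
      apply/eqP; rewrite -subr_eq0 -qnormsq_eq0 /qnormsq /=.
      by apply/eqP; ring.
    rewrite !qnorm_conj -!(opprB (val w _ _)) !qnormN.
    have KE (x : R) : 3 * x = x + 2 * x by ring.
    rewrite /K KE mulrDr.
    apply: lerD.
      by apply: ler_pM; rewrite ?qnorm_ge0 ?zM // ltW.
    by rewrite mulrC; apply: ler_pM; rewrite ?qnorm_ge0 ?wM // ltW.
  have bs : qnorm b <= s.
    rewrite qnormM qnorm_conj.
    have le_s l : qnorm (val z l 0) ^+ 2 <= s.
      rewrite sqr_qnorm /s /vnormsq (bigD1 l) //= lerDl sumr_ge0 // => ? _.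
      exact: qnormsq_ge0.
    have := le_s i; have := le_s j.
    have := sqr_ge0 (qnorm (val z i 0) - qnorm (val z j 0)); rewrite sqrrB.
    by lra.
  have -> : b * qreal s^-1 - a * qreal t^-1 =
      (b - a) * qreal t^-1 + b * qreal ((t - s) / (s * t)).
    have -> : (t - s) / (s * t) = s^-1 - t^-1.
      by field; rewrite !gt_eqF.
    have -> : qreal (s^-1 - t^-1) = qreal s^-1 - qreal t^-1.
      by apply/eqP; rewrite eq_sym subr_eq -qrealD subrK.
    by rewrite mulrBl mulrBr [RHS]addrC addrA subrK.
  apply: le_trans (qnormD _ _) _; rewrite !qnormM !qnorm_real.
  rewrite mulrCA (mulrDr e) mulrDr.
  apply: lerD.
    rewrite mulrC ger0_norm ?invr_ge0 ?(ltW t0) //.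
    by apply: ler_pM; rewrite ?qnorm_ge0 ?invr_ge0 ?(ltW t0).
  rewrite normrM normfV (ger0_norm (ltW (mulr_gt0 s0 t0))) invfM.
  apply: (@le_trans _ _ (s * (`|t - s| * (s^-1 * t^-1)))).
    rewrite -[X in X * _ <= _]qnormM; apply: ler_wpM2r; last exact: bs.
    by rewrite !mulr_ge0 ?normr_ge0 ?invr_ge0 ?(ltW t0) ?(ltW s0).
  have -> : s * (`|t - s| * (s^-1 * t^-1)) = t^-1 * `|t - s|.
    by field; rewrite !gt_eqF.
  by apply: ler_pM; rewrite ?invr_ge0 ?(ltW t0).
- have /(oU _)[e e0 eU] : U (proj_pt (repr p)) by rewrite repr_proj_pt.
  set z := val (repr p) in eU.
  have [i0 zi0] : exists i, z i 0 != 0.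
    apply/existsP; apply: contraT; rewrite negb_exists => /forallP z0.
    have := valP (repr p); rewrite -/z => /eqP; case.
    apply/matrixP => i j; rewrite ord1 mxE; apply/eqP.
    by have := z0 i; rewrite negbK.
  pose M := \sum_j qnorm (z j 0) + 1.
  have M0 : 0 < M.
    by rewrite ltr_wpDl // sumr_ge0 // => j _; exact: qnorm_ge0.
  pose d := Num.min e (qnorm (z i0 0)).
  have d0 : 0 < d.
    by rewrite lt_min e0 lt_neqAle qnorm_ge0 eq_sym qnorm_eq0 zi0.
  apply/nbhs_ballP; exists (d / M) => /=; first by rewrite divr_gt0.
  rewrite ballEmdist => q /=; rewrite [mdist _ _]/(proj_dist _ _) => pq.
  pose w := projector q *m z.
  have wz i : qnorm (w i 0 - z i 0) < d.
    have -> : w i 0 - z i 0 = \sum_j (projector q i j - projector p i j) * z j 0.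
      under eq_bigr do rewrite mulrBl.
      rewrite sumrB; congr (_ - _); first by rewrite mxE.
      by rewrite -{1}[z](projector_id p) mxE.
    apply: le_lt_trans (qnorm_sum _ _) _.
    move: pq; rewrite ltr_pdivlMr //; apply: le_lt_trans.
    rewrite mulrC /M mulrDl mul1r mulr_suml.
    rewrite -[X in X <= _]addr0; apply: lerD; last first.
      by do 2 (apply: sumr_ge0 => ? _); exact: qnorm_ge0.
    apply: ler_sum => j _; rewrite qnormM [X in X <= _]mulrC.
    apply: ler_wpM2l; first exact: qnorm_ge0.
    rewrite -opprB qnormN (bigD1 i) //= (bigD1 j) //= -addrA lerDl.
    rewrite addr_ge0 ?sumr_ge0 // => ? _; rewrite ?sumr_ge0 ?qnorm_ge0 // => ? _.
    exact: qnorm_ge0.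
  have w0 : w != 0.
    apply/eqP => w0; have := wz i0.
    by rewrite w0 mxE sub0r qnormN lt_min ltxx andbF.
  have -> : q = proj_pt (Sub w w0 : nzvec R N).
    rewrite -[LHS]repr_proj_pt; apply/esym/proj_ptP; rewrite SubK.
    have [a wa] := projector_line q z; exists a => //.
    apply: contra_neq w0 => a0; by rewrite /w wa a0 raddf0 mulmx0.
  apply: eU => i; rewrite SubK; have := wz i.
  by rewrite lt_min => /andP[].
Qed.

End Topology.

Section LinearGroups.
Variables (R : realType) (N : nat).
Local Notation H := (quat R).

Definition qdet (A : 'M[H]_N) : R[i] :=
  let A1 := map_mx (@qa R) A in
  let A2 := map_mx (@qb R) A in
  \det (block_mx A1 A2 (- map_mx conjc A2) (map_mx conjc A1)).

Lemma qdetN (A : 'M[H]_N) : qdet (- A) = qdet A.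
Proof.
rewrite /qdet.
have -> : block_mx (map_mx (@qa R) (- A)) (map_mx (@qb R) (- A))
    (- map_mx conjc (map_mx (@qb R) (- A))) (map_mx conjc (map_mx (@qa R) (- A))) =
  (-1) *: block_mx (map_mx (@qa R) A) (map_mx (@qb R) A)
    (- map_mx conjc (map_mx (@qb R) A)) (map_mx conjc (map_mx (@qa R) A)).
  rewrite scaleN1r opp_block_mx; congr block_mx;
    by apply/matrixP => i j; rewrite !mxE //= rmorphN.
by rewrite detZ exprD -expr2 sqrr_sign mul1r.
Qed.

Definition SL := {g : 'M[H]_N | qdet g == 1}.

Definition psl_rel (g h : SL) : bool := (val g == val h) || (val g == - val h).

Lemma psl_rel_refl : reflexive psl_rel.
Proof. by move=> g; rewrite /psl_rel eqxx. Qed.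

Lemma psl_rel_sym : symmetric psl_rel.
Proof.
by move=> g h; rewrite /psl_rel eq_sym [_ == - val g]eq_sym -eqr_oppLR.
Qed.

Lemma psl_rel_trans : transitive psl_rel.
Proof.
move=> h g l /orP[]/eqP gh /orP[]/eqP hl; rewrite /psl_rel gh hl ?opprK eqxx //;
  by rewrite orbT.
Qed.

Canonical psl_equiv := EquivRel psl_rel psl_rel_refl psl_rel_sym psl_rel_trans.

Definition PSL := {eq_quot psl_equiv}.
HB.instance Definition _ := Choice.on PSL.
HB.instance Definition _ := EqQuotient.on PSL.

Definition psl_class (g : SL) : PSL := \pi_PSL g.

(* The class of g v if g v != 0; the value when g v = 0, which does not occur for
   invertible g, is immaterial. *)
Definition proj_map (g : 'M[H]_N) (p : proj R N) : proj R N :=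
  proj_pt (insubd (repr p) (g *m val (repr p))).

Definition psl_map (gamma : PSL) : proj R N -> proj R N :=
  proj_map (val (repr gamma)).

Definition diagonalizable_quat (A : 'M[H]_N) :=
  exists P Q : 'M[H]_N, [/\ P *m Q = 1%:M, Q *m P = 1%:M & is_diag_mx (Q *m A *m P)].

Definition right_eigenvalue (A : 'M[H]_N) (a : H) :=
  exists2 v : 'cV[H]_N, v != 0 & A *m v = v *m a%:M.

Definition loxoparabolic (gamma : PSL) :=
  forall g : SL, psl_class g = gamma ->
    ~ diagonalizable_quat (val g) /\
    exists2 a : H, right_eigenvalue (val g) a & qnorm a != 1.

Definition jordan_block (mu : R[i]) (r : nat) : 'M[H]_r :=
  \matrix_(i, j) (if i == j then qcplx mu else (i.+1 == j)%:R).

Definition quat_jordan_form (A : 'M[H]_N) :=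
  exists (s : nat) (r : 'I_s -> nat) (mu : 'I_s -> R[i])
    (e : N = (\sum_(l < s) r l)%N),
  [/\ forall l, (0 < r l)%N,
      forall l, 0 <= complex.Im (mu l) &
      castmx (e, e) A = \mxdiag_(l < s) jordan_block (mu l) (r l)].

Definition parabolic_block (A : 'M[H]_N) :=
  [/\ quat_jordan_form A,
      ~ diagonalizable_quat A &
      forall a : H, right_eigenvalue A a -> qnorm a = 1].

End LinearGroups.

Section ProjectiveMaps.
Variables (R : realType) (N : nat).
Local Notation H := (quat R).

Lemma proj_map_pt (g : 'M[H]_N) (v w : nzvec R N) :
  val w = g *m val v -> proj_map g (proj_pt v) = proj_pt w.
Proof.
move=> wv; rewrite /proj_map; set z := repr _.
have /proj_ptP[a a0 za] : proj_pt z = proj_pt v by rewrite repr_proj_pt.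
have gz : g *m val z = val w *m a%:M by rewrite za wv mulmxA.
have gz0 : g *m val z != 0.
  apply: contra_neq (valP w) => gz0.
  by rewrite -[LHS]mulmx1 -(divrr (a0 : a \is a GRing.unit)) scalar_mxM mulmxA
    -gz gz0 mul0mx.
by apply/proj_ptP; exists a; rewrite // insubdK.
Qed.

Lemma proj_mapN (g : 'M[H]_N) : proj_map (- g) = proj_map g.
Proof.
apply/funext => p; rewrite /proj_map mulNmx.
have [gv0|gv0] := eqVneq (g *m val (repr p)) 0.
  by rewrite gv0 oppr0.
apply/proj_ptP; exists (-1); first by rewrite oppr_eq0 oner_neq0.
rewrite !insubdK //; last by rewrite unfold_in oppr_eq0.
move: (g *m _) => v.
by apply/matrixP => i j; rewrite ord1 !mxE big_ord1 mxE eqxx mulr1n mulrN1.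
Qed.

Lemma psl_map_class (g : SL R N) : psl_map (psl_class g) = proj_map (val g).
Proof.
rewrite /psl_map; have /eqmodP : psl_class (repr (psl_class g)) = psl_class g.
  exact: reprK.
by rewrite /= /psl_rel => /orP[]/eqP ->; rewrite ?proj_mapN.
Qed.

End ProjectiveMaps.

(* The subgroup generated by f in the group of bijections of T. *)
Definition cyclic_group (T : Type) (f : T -> T) : set (T -> T) :=
  [set h | exists l : nat,
    h = iter l f \/ (cancel h (iter l f) /\ cancel (iter l f) h)].

Definition normal_family (X : topologicalType) (Y : uniformType) (U : set X)
    (F : set (X -> Y)) :=
  forall g : nat -> X -> Y, (forall l, F (g l)) ->
  exists (phi : nat -> nat) (f : X -> Y),
    {homo phi : i j / (i < j)%N} /\
    forall K : set X, K `<=` U -> compact K ->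
      {uniform K, (fun l => g (phi l)) @ \oo --> f}.

Definition equicontinuity_region (X : uniformType) (G : set (X -> X)) : set X :=
  [set z | exists U : set X, [/\ open U, U z & normal_family U G]].

Section Subspaces.
Variables (R : realType) (N : nat).
Local Notation H := (quat R).

Definition right_subspace (W : set 'cV[H]_N) :=
  [/\ W 0, forall v w, W v -> W w -> W (v + w) &
      forall v (a : H), W v -> W (v *m a%:M)].

Definition projectivization (W : set 'cV[H]_N) : set (proj R N) :=
  [set proj_pt v | v in [set v : nzvec R N | W (val v)]].

Definition proj_span (S : set (proj R N)) : set (proj R N) :=
  \bigcap_(P in [set P | S `<=` P /\
      exists2 W, right_subspace W & P = projectivization W]) P.

Lemma std_vec_neq0 (j : 'I_N) : delta_mx j 0 != 0 :> 'cV[H]_N.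
Proof.
by apply/eqP => /matrixP/(_ j 0)/eqP; rewrite !mxE !eqxx oner_eq0.
Qed.

Definition std_pt (j : 'I_N) : proj R N := proj_pt (Sub (delta_mx j 0) (std_vec_neq0 j)).

(* Image of S under [v] |-> [0, v, 0], where v : 'cV_m fills the coordinates
   o, ..., o + m - 1. *)
Definition block_incl (o m : nat) (S : set (proj R m)) : set (proj R N) :=
  [set p | exists (v : nzvec R m) (w : nzvec R N),
    [/\ S (proj_pt v), p = proj_pt w &
      val w = (\matrix_(a, b) (a == o + b :> nat)%:R) *m val v]].

End Subspaces.

(* Main.v *)
From HB Require Import structures.
Require Import Defs.
From mathcomp Require Import all_boot all_order all_algebra.
From mathcomp Require Import complex ring lra.
From mathcomp Require Import all_classical all_reals all_analysis.

Set Implicit Arguments.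
Unset Strict Implicit.
Unset Printing Implicit Defensive.

Import Order.TTheory GRing.Theory Num.Theory.
Import numFieldNormedType.Exports.

Local Open Scope classical_set_scope.
Local Open Scope ring_scope.

(** Rescale the powers of a matrix M by sqrt (c t) so that c t |M^t v|^2 converges
    to a function G, the square of a seminorm. A rescaled family of matrices is
    bounded, so it has convergent subsequences, and on the points where the family
    of norms stays away from 0 the induced projective maps converge uniformly on
    compact sets. If G vanishes at z but not at u, then the rescaled powers crush
    z while keeping u of bounded size, and points z + u x with x small are spread
    over distinct directions, so normality fails at z. Hence the complement of the
    equicontinuity region of <M> is the union of the zero sets of G for M and for
    its inverse. For a parabolic block the powers of J(mu, r) are Toeplitz with
    binomial entries, so both functions equal the sum of |v_last|^2 / (q!)^2 over
    the largest Jordan blocks, of size q + 1. For the block diagonal matrix the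
    factor |lambda_k|^t dominates forwards and |lambda_1|^-t backwards, so G only
    depends on the last block, respectively on the first one. *)

(** * Norms of quaternions and of quaternionic vectors *)

Section Norms.
Variable R : realType.
Local Notation H := (quat R).

Lemma divqq (a : H) : a != 0 -> a * a^-1 = 1.
Proof. by move=> a0; rewrite divrr. Qed.

Lemma qnormV (a : H) : a != 0 -> qnorm a^-1 = (qnorm a)^-1.
Proof.
move=> a0; apply: (mulfI (x := qnorm a)); first by rewrite qnorm_eq0.
rewrite -qnormM divqq // divff ?qnorm_eq0 //.
by rewrite -qreal1 qnorm_real normr1.
Qed.

Lemma qnormB_sym (a b : H) : qnorm (a - b) = qnorm (b - a).
Proof. by rewrite -opprB qnormN. Qed.

(** By the parallelogram law the two sides differ by [qnormsq (a - b)]. This weak triangle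
    inequality keeps later estimates free of square roots. *)
Lemma qnormsqD_le (a b : H) : qnormsq (a + b) <= 2 * qnormsq a + 2 * qnormsq b.
Proof.
case: a b => [[a b] [c d]] [[e f] [g h]]; rewrite /qnormsq /= -subr_ge0.
have -> : 2 * (a ^+ 2 + b ^+ 2 + c ^+ 2 + d ^+ 2) +
   2 * (e ^+ 2 + f ^+ 2 + g ^+ 2 + h ^+ 2) -
   ((a + e) ^+ 2 + (b + f) ^+ 2 + (c + g) ^+ 2 + (d + h) ^+ 2) =
   (a - e) ^+ 2 + (b - f) ^+ 2 + (c - g) ^+ 2 + (d - h) ^+ 2 by ring.
by rewrite !addr_ge0 ?sqr_ge0.
Qed.

Lemma qnormsq_qreal (x : R) : qnormsq (qreal x) = x ^+ 2.
Proof. by rewrite /qnormsq /= !expr0n /= !addr0. Qed.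

Section Vectors.
Variable N : nat.
Implicit Types (v w : 'cV[H]_N) (P L : 'M[H]_N).

Definition nzv v (v0 : v != 0) : nzvec R N :=
  exist (fun u : 'cV[H]_N => u != 0) v v0.

Lemma scaler_mxE v (a : H) i : (v *m a%:M) i 0 = v i 0 * a.
Proof. by rewrite mxE big_ord1 mxE eqxx mulr1n. Qed.

Lemma vnormsqZ v (a : H) : vnormsq (v *m a%:M) = vnormsq v * qnormsq a.
Proof.
by rewrite /vnormsq mulr_suml; apply: eq_bigr => i _; rewrite scaler_mxE qnormsqM.
Qed.

Lemma vnormsqZl (a : H) v : vnormsq (a *: v) = qnormsq a * vnormsq v.
Proof.
by rewrite /vnormsq mulr_sumr; apply: eq_bigr => i _; rewrite mxE qnormsqM.
Qed.

Lemma vnormsq_gt0 v : (0 < vnormsq v) = (v != 0).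
Proof. by rewrite lt_neqAle vnormsq_ge0 andbT eq_sym vnormsq_eq0. Qed.

Lemma vnormsqD_le v w : vnormsq (v + w) <= 2 * vnormsq v + 2 * vnormsq w.
Proof.
rewrite /vnormsq !mulr_sumr -big_split; apply: ler_sum => i _.
by rewrite mxE; exact: qnormsqD_le.
Qed.

Lemma le_qnormsq_vnormsq v i : qnormsq (v i 0) <= vnormsq v.
Proof.
rewrite /vnormsq (bigD1 i) //= lerDl sumr_ge0 // => l _; exact: qnormsq_ge0.
Qed.

Lemma qnorm_le_sqrt v i (b : R) : vnormsq v <= b -> qnorm (v i 0) <= Num.sqrt b.
Proof.
move=> vb; rewrite ler_sqrt ?(le_trans (vnormsq_ge0 v)) //.
exact: le_trans (le_qnormsq_vnormsq v i) vb.
Qed.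

Lemma vnormsq_le v (b : R) : (forall i, qnorm (v i 0) <= b) ->
  vnormsq v <= N%:R * b ^+ 2.
Proof.
move=> vb; rewrite mulr_natl -[X in _ *+ X]card_ord -sumr_const.
apply: ler_sum => i _; rewrite -sqr_qnorm.
by rewrite lerXn2r ?nnegrE ?qnorm_ge0 // (le_trans (qnorm_ge0 (v i 0))).
Qed.

Lemma exists_large_coord v : v != 0 ->
  exists i, vnormsq v <= N%:R * qnormsq (v i 0).
Proof.
move=> v0; apply: contrapT => /forallNP vN.
have : N%:R * vnormsq v < vnormsq v * N%:R.
  have -> : vnormsq v * N%:R = \sum_(i < N) vnormsq v.
    by rewrite sumr_const card_ord mulr_natr.
  rewrite {1}/vnormsq mulr_sumr.
  (* Strict inequality of the sums needs an index; for [N = 0] the vector would be zero. *)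
  have [i vi0] : exists i : 'I_N, true.
    case: (N) v v0 {vN} => [|N' ? _]; last by exists ord0.
    by move=> v; rewrite [v]flatmx0 eqxx.
  apply: ltr_sum; first by apply/hasP; exists i; rewrite ?mem_index_enum.
  by move=> j _; rewrite ltNge; apply/negP; exact: vN.
by rewrite mulrC ltxx.
Qed.

Lemma mulmx_coord_le P v (B : R) i : (forall j, qnorm (P i j) <= B) ->
  qnorm ((P *m v) i 0) <= B * \sum_j qnorm (v j 0).
Proof.
move=> PB; rewrite mxE; apply: le_trans (qnorm_sum _ _) _.
rewrite mulr_sumr; apply: ler_sum => j _; rewrite qnormM.
by apply: ler_wpM2r; rewrite ?qnorm_ge0.
Qed.

(** Splits [P w - L v] as [P (w - v) + (P - L) v], so that the point and the matrix can vary at the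
    same time. *)
Lemma mulmx_dist_le P L v w (B e d : R) i :
  (forall j, qnorm (P i j) <= B) -> (forall j, qnorm (w j 0 - v j 0) <= e) ->
  (forall j, qnorm (P i j - L i j) <= d) ->
  qnorm ((P *m w) i 0 - (L *m v) i 0) <=
    B * (N%:R * e) + d * \sum_j qnorm (v j 0).
Proof.
move=> PB we PLd.
have -> : (P *m w) i 0 - (L *m v) i 0 =
    (P *m (w - v)) i 0 + ((P - L) *m v) i 0.
  by rewrite mulmxBl mulmxBr !mxE addrA subrK.
apply: le_trans (qnormD _ _) _; apply: lerD; last first.
  by apply: mulmx_coord_le => j; rewrite !mxE.
apply: le_trans (mulmx_coord_le _ PB) _.
case: (leP 0 B) => B0.
  apply: ler_wpM2l => //.
  rewrite mulr_natl -[X in _ *+ X]card_ord -sumr_const.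
  by apply: ler_sum => j _; rewrite !mxE.
(* A negative [B] cannot bound a norm, so there is no index [j] and both sums are empty. *)
have N0 (j : 'I_N) : False.
  by have := le_lt_trans (PB j) B0; rewrite ltNge qnorm_ge0.
have -> : (\sum_j qnorm ((w - v) j 0)) = 0 :> R by apply: big1 => j; case: (N0 j).
by rewrite mulr0; case: (N) N0 => [|n]; rewrite ?mul0r ?mulr0 // => /(_ ord0).
Qed.

End Vectors.
End Norms.

(** * Convergent subsequences of bounded matrices *)

Section Subsequences.
Variable R : realType.
Local Notation H := (quat R).

Lemma homo_ltn_ge (phi : nat -> nat) : {homo phi : i j / (i < j)%N} ->
  forall s, (s <= phi s)%N.
Proof. by move=> inc; elim=> // s IH; apply: leq_ltn_trans IH (inc _ _ _). Qed.

Lemma homo_ltn_cvg (phi : nat -> nat) : {homo phi : i j / (i < j)%N} ->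
  phi s @[s --> \oo] --> \oo.
Proof.
move=> inc A [n _ nA]; exists n => // s /= ns; apply: nA => /=.
exact: leq_trans ns (homo_ltn_ge inc s).
Qed.

Lemma cvg_subseq (T : topologicalType) (u : nat -> T) (l : T) (phi : nat -> nat) :
  {homo phi : i j / (i < j)%N} -> u s @[s --> \oo] --> l ->
  u (phi s) @[s --> \oo] --> l.
Proof.
by move=> /homo_ltn_cvg inc ul; exact: (cvg_comp phi u inc ul).
Qed.

(** Bolzano-Weierstrass is applied to one index after another, refining the subsequence each time;
    convergence already obtained survives refinement. *)
Lemma common_cvg_subseq (I : finType) (u : I -> nat -> R) (B : R) :
  (forall i s, `|u i s| <= B) ->
  exists2 phi : nat -> nat, {homo phi : i j / (i < j)%N} &
    forall i, cvgn (fun s => u i (phi s)).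
Proof.
move=> uB.
suff [phi inc cv] : exists2 phi : nat -> nat, {homo phi : i j / (i < j)%N} &
    forall i, i \in enum I -> cvgn (fun s => u i (phi s)).
  by exists phi => // i; apply: cv; rewrite mem_enum.
elim: (enum I) => [|i r [phi inc cv]]; first by exists id.
have bu : bounded_fun (fun s => u i (phi s)).
  by exists B; split; [exact: num_real|move=> x Bx s _ /=; apply: le_trans (ltW Bx)].
have [psi /increasing_seqP psi_inc ucv] := bolzano_weierstrass bu.
have psi_homo : {homo psi : a b / (a < b)%N}.
  by apply: homo_ltn => //; exact: ltn_trans.
exists (phi \o psi) => [a b ab|j]; first exact/inc/psi_homo.
rewrite inE => /orP[/eqP-> //|jr].
by have /cvg_ex[l ul] := cv j jr; apply/cvg_ex; exists l; exact: cvg_subseq ul.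
Qed.

(** The four real coordinates are indexed by a finite type, so that [common_cvg_subseq] handles all
    coordinates of all matrix entries at once. *)
Definition qcoord (b : bool * bool) (q : H) : R :=
  let c := if b.1 then qa q else qb q in
  if b.2 then complex.Re c else complex.Im c.

Lemma qcoord_le b (q : H) : `|qcoord b q| <= qnorm q.
Proof.
rewrite -sqrtr_sqr ler_sqrt ?qnormsq_ge0 //.
case: q b => [[a b] [c d]] [[] []]; rewrite /qcoord /qnormsq /=.
all: have := (sqr_ge0 a, sqr_ge0 b, sqr_ge0 c, sqr_ge0 d).
all: by move=> [[[? ?] ?] ?]; lra.
Qed.

(** The constant 2 is the square root of the number of real coordinates. *)
Lemma qnorm_le_coord (q : H) (e : R) : (forall b, `|qcoord b q| <= e) ->
  qnorm q <= 2 * e.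
Proof.
move=> qe; have e0 : 0 <= e := le_trans (normr_ge0 _) (qe (true, true)).
rewrite -[leRHS]ger0_norm ?mulr_ge0 // -sqrtr_sqr ler_sqrt ?sqr_ge0 //.
have sq b : qcoord b q ^+ 2 <= e ^+ 2.
  by rewrite -real_normK ?num_real // lerXn2r ?nnegrE.
have := (sq (true, true), sq (true, false), sq (false, true), sq (false, false)).
case: q {qe sq} => [[a b] [c d]]; rewrite /qcoord /qnormsq /= exprMn.
by move=> [[[? ?] ?] ?]; lra.
Qed.

Lemma qcoordB b (p q : H) : qcoord b (p - q) = qcoord b p - qcoord b q.
Proof. by case: p q b => [[a b] [c d]] [[? ?] [? ?]] [[] []]. Qed.

(** Quaternionic matrices are given no topology here, so convergence is expressed entrywise with an
    explicit [e]. *)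
Lemma bounded_mx_cvg_subseq (N : nat) (P : nat -> 'M[H]_N) (B : R) :
  (forall s i j, qnorm (P s i j) <= B) ->
  exists (phi : nat -> nat) (L : 'M[H]_N), {homo phi : i j / (i < j)%N} /\
    forall e, 0 < e ->
      \forall s \near \oo, forall i j, qnorm (P (phi s) i j - L i j) <= e.
Proof.
move=> PB.
have uB (x : ('I_N * 'I_N) * (bool * bool)) s :
    `|qcoord x.2 (P s x.1.1 x.1.2)| <= B.
  exact: le_trans (qcoord_le _ _) (PB _ _ _).
have [phi inc cv] := common_cvg_subseq uB.
pose l i j b := lim (qcoord b (P (phi s) i j) @[s --> \oo]).
exists phi, (\matrix_(i, j) Quat (Complex (l i j (true, true)) (l i j (true, false)))
  (Complex (l i j (false, true)) (l i j (false, false)))); split => // e e0.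
have e2 : 0 < e / 2 by rewrite divr_gt0.
have near1 (x : ('I_N * 'I_N) * (bool * bool)) : \forall s \near \oo,
    `|l x.1.1 x.1.2 x.2 - qcoord x.2 (P (phi s) x.1.1 x.1.2)| <= e / 2.
  by have /cvgrPdist_le/(_ _ e2) := cv x.
have near2 : \forall s \near \oo, forall x : ('I_N * 'I_N) * (bool * bool),
    `|l x.1.1 x.1.2 x.2 - qcoord x.2 (P (phi s) x.1.1 x.1.2)| <= e / 2.
  exact: filter_forall.
apply: filterS near2 => s sl i j.
rewrite -[e](mulfVK (_ : 2 != 0 :> R)) // mulrC.
apply: qnorm_le_coord => b; rewrite qcoordB mxE distrC.
by have := sl ((i, j), b); case: b => [[] []].
Qed.

End Subsequences.

(** * Neighbourhoods in projective space, read in homogeneous coordinates *)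

Section ProjectiveNeighbourhoods.
Variables (R : realType) (N : nat).
Local Notation H := (quat R).
Local Notation PS := (Defs.proj R N).

Lemma nbhs_proj_pt (v : nzvec R N) (S : set PS) : nbhs (proj_pt v) S <->
  exists2 e : R, 0 < e & forall w : nzvec R N,
    (forall i, qnorm (val w i 0 - val v i 0) < e) -> S (proj_pt w).
Proof.
split=> [|[e e0 eS]].
  rewrite nbhsE => -[U [oU Uv] US].
  have [e e0 eU] := (Defs.proj_open U).1 oU v Uv.
  by exists e => // w /eU/US.
pose U : set PS := [set p | exists2 w : nzvec R N, p = proj_pt w &
  forall i, qnorm (val w i 0 - val v i 0) < e].
have vU : U (proj_pt v).
  by exists v => // i; rewrite subrr qnorm0.
apply: (@filterS _ _ _ U) => [p [w -> wv]|]; first exact: eS.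
(* The image of the cube around [v] is open: a representative [z] of one of its points is [w a] with
   [w] in the cube, and a point near [z], divided by [a], stays in the cube. *)
apply: open_nbhs_nbhs; split=> //; apply/Defs.proj_open => z [w /proj_ptP[a a0 za] wv].
have na0 : 0 < qnorm a by rewrite lt_neqAle eq_sym qnorm_eq0 a0 qnorm_ge0.
have [d d0 dw] : exists2 d, 0 < d & forall i, qnorm (val w i 0 - val v i 0) + d <= e.
  have ew i : 0 < e - qnorm (val w i 0 - val v i 0) by rewrite subr_gt0.
  exists (\big[Num.min/e]_i (e - qnorm (val w i 0 - val v i 0))).
    by elim/big_ind: _ => // x y x0 y0; rewrite lt_min x0.
  by move=> i; rewrite addrC -lerBrDr; exact: bigmin_le_cond.
(* Here [d] is the room that [w] leaves inside the cube; dividing by [a] divides distances by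
   [qnorm a]. *)
exists (d * qnorm a) => [|x xz]; first exact: mulr_gt0.
have xa0 : val x *m (a^-1)%:M != 0.
  apply: contra_neq (valP x) => /(congr1 (mulmx^~ a%:M)).
  by rewrite mul0mx -mulmxA -scalar_mxM mulVr // mulmx1.
exists (nzv xa0).
  by apply/proj_ptP; exists a => //=; rewrite -mulmxA -scalar_mxM mulVr // mulmx1.
move=> i /=; rewrite scaler_mxE; apply: lt_le_trans (dw i).
have -> : val x i 0 * a^-1 - val v i 0 =
    (val w i 0 - val v i 0) + (val x i 0 - val z i 0) * a^-1.
  by rewrite za scaler_mxE mulrBl -mulrA divqq // mulr1 [RHS]addrC addrA subrK.
apply: le_lt_trans (qnormD _ _) _; rewrite ltrD2l qnormM qnormV //.
by rewrite ltr_pdivrMr.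
Qed.

End ProjectiveNeighbourhoods.

(** * Normality from boundedness and a lower bound *)

Section Normality.
Variables (R : realType) (N : nat).
Local Notation H := (quat R).
Local Notation PS := (Defs.proj R N).

(** A bounded sequence of matrices has a subsequence with an entrywise limit [L]. The lower bound
    passes to the limit, so [L] kills no point over [U]. Near such a point [P (phi s)] and [L] both
    send vectors close to [L v], which is nonzero, and the projective images are close too. *)
Lemma normal_of_lower_bound (F : set 'M[H]_N) (U : set PS) (B : R) :
  (forall P, F P -> forall i j, qnorm (P i j) <= B) ->
  (forall v : nzvec R N, U (proj_pt v) ->
    exists2 d : R, 0 < d & forall P, F P -> d <= vnormsq (P *m val v)) ->
  normal_family U [set proj_map P | P in F].
Proof.
move=> FB Ulow g gF.
have [P /all_and2[FP Pg]] : {P : nat -> 'M[H]_N & forall s, F (P s) /\ proj_map (P s) = g s}.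
  by apply: (@choice _ _ (fun s M => F M /\ proj_map M = g s)) => s; case: (gF s) => M; exists M.
have PB s i j : qnorm (P s i j) <= B by exact: FB.
have [phi [L [inc PL]]] := bounded_mx_cvg_subseq PB.
exists phi, (proj_map L); split=> // K KU cK S /uniform_nbhs[E [entE ES]].
move: entE; rewrite -entourage_ballE => -[e /= e0 eE].
have e2 : 0 < e / 2 by rewrite divr_gt0.
(* Compactness reduces uniform convergence on [K] to an estimate near each point, jointly in the
   point and the index. *)
have := (compact_near_coveringP K).1 cK nat \oo
  (fun s p => ball (proj_map L p) e (proj_map (P (phi s)) p)) _.
move=> /(_ _)[x Kx|n nn nK]; last first.
  exists n => // s ns; apply: ES => y Ky; apply: eE; rewrite -Pg; exact: nK.
rewrite -[x]repr_proj_pt; set v := repr x.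
have [d d0 dP] : exists2 d : R, 0 < d & forall P, F P -> d <= vnormsq (P *m val v).
  by apply: Ulow; rewrite repr_proj_pt; exact: KU.
pose V := \sum_j qnorm (val v j 0).
have V0 : 0 <= V by apply: sumr_ge0 => j _; exact: qnorm_ge0.
(* The extra 1 makes [C] bound the entries of [L] too, which lie within [t <= 1] of those of some
   [P (phi s)]. *)
pose C := `|B| + 1.
have C0 : 0 < C by rewrite ltr_wpDl.
have BC : B <= C by rewrite /C; have := ler_norm B; lra.
have Lv0 : L *m val v != 0.
  (* If [L v = 0], an index with entries within [t] of [L] has squared norm at [v] at most
     [N (t V)^2 <= t M <= d / 2], against the lower bound. *)
  apply/eqP => Lv.
  pose M := N%:R * V ^+ 2 + 1.
  have M0 : 0 < M by rewrite ltr_wpDl // mulr_ge0 ?sqr_ge0.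
  pose t := Num.min 1 (d / 2 / M).
  have t0 : 0 < t by rewrite lt_min ltr01 !divr_gt0.
  have [s _ /(_ s (leqnn s)) sL] := PL t t0.
  have := dP _ (FP (phi s)); apply/negP; rewrite -ltNge.
  apply: (@le_lt_trans _ _ (N%:R * (t * V) ^+ 2)).
    apply: vnormsq_le => i.
    have := @mulmx_dist_le R N (P (phi s)) L (val v) (val v) B 0 t i.
    rewrite Lv [X in _ - X]mxE subr0 !mulr0 add0r; apply => j //.
    by rewrite subrr qnorm0.
  apply: (@le_lt_trans _ _ (t * M)).
    rewrite exprMn mulrCA /M expr2 -mulrA ler_pM2l //.
    have t1 : t <= 1 by rewrite ge_min lexx.
    apply: (@le_trans _ _ (1 * (N%:R * V ^+ 2))); last by rewrite mul1r lerDl.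
    by rewrite ler_wpM2r // mulr_ge0 ?sqr_ge0.
  apply: (@le_lt_trans _ _ (d / 2 / M * M)).
    by rewrite ler_pM2r // ge_min lexx orbT.
  by rewrite divfK ?gt_eqF // ltr_pdivrMr // ltr_pMr // ltr1n.
have [i0 Lvi0] : exists i, (L *m val v) i 0 != 0.
  apply/existsP; apply: contraT; rewrite negb_exists => /forallP z0.
  case/eqP: Lv0; apply/matrixP => i j; rewrite ord1 [RHS]mxE; apply/eqP.
  by have := z0 i; rewrite negbK.
have nb : nbhs (proj_pt (nzv Lv0)) (ball (proj_pt (nzv Lv0)) (e / 2)).
  exact: nbhsx_ballx.
have [r0 r00 rball] := (nbhs_proj_pt _ _).1 nb.
(* The second bound forces every vector within [r] of [L v] to be nonzero, so [proj_map] does not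
   take its default value there. *)
pose r := Num.min r0 (qnorm ((L *m val v) i0 0)).
have rgt0 : 0 < r by rewrite lt_min r00 lt_neqAle eq_sym qnorm_eq0 Lvi0 qnorm_ge0.
have near_ball (M : 'M[H]_N) (w : nzvec R N) :
    (forall i, qnorm ((M *m val w) i 0 - (L *m val v) i 0) < r) ->
    ball (proj_pt (nzv Lv0)) (e / 2) (proj_map M (proj_pt w)).
  move=> Mr.
  have Mw0 : M *m val w != 0.
    apply/eqP => Mw; have := Mr i0.
    by rewrite Mw [X in X - _]mxE sub0r qnormN lt_min ltxx andbF.
  rewrite (@proj_map_pt _ _ M w (nzv Mw0)) //; apply: rball => i /=.
  by have := Mr i; rewrite lt_min => /andP[].
(* The scales [y] for vectors and [t] for matrices each use up half of [r] in [mulmx_dist_le]. *)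
pose y := r / 2 / (C * N%:R + 1).
have CN0 : 0 < C * N%:R + 1 by rewrite ltr_wpDl // mulr_ge0 // ltW.
have y0 : 0 < y by rewrite !divr_gt0.
pose t := Num.min 1 (r / 2 / (V + 1)).
have V10 : 0 < V + 1 by rewrite ltr_wpDl.
have t0 : 0 < t by rewrite lt_min ltr01 !divr_gt0.
have Cy : C * (N%:R * y) < r / 2.
  rewrite mulrA /y mulrCA -[ltRHS]mulr1 ltr_pM2l ?divr_gt0 //.
  by rewrite ltr_pdivrMr // mul1r ltrDl.
have tV : t * V <= r / 2.
  apply: (@le_trans _ _ (r / 2 / (V + 1) * V)).
    by rewrite ler_wpM2r // ge_min lexx orbT.
  by rewrite -mulrA ler_piMr ?divr_ge0 ?(ltW rgt0) // mulrC ler_pdivrMr // mul1r lerDl.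
exists ([set p | exists2 w : nzvec R N, p = proj_pt w &
    forall i, qnorm (val w i 0 - val v i 0) < y],
  [set s | forall i j, qnorm (P (phi s) i j - L i j) <= t]).
  split=> /=; last exact: PL.
  by apply/nbhs_proj_pt; exists y => // w wv; exists w.
case=> p s /= [[w -> wv] sL]; rewrite [X in ball _ X](splitr e).
(* Applied to [L] itself with [t' = 0] and to [P (phi s)] with [t' = t]. *)
have lt_r (M : 'M[H]_N) (t' : R) : (forall i j, qnorm (M i j) <= C) -> t' <= t ->
    (forall i j, qnorm (M i j - L i j) <= t') ->
    forall i, qnorm ((M *m val w) i 0 - (L *m val v) i 0) < r.
  move=> MC t't ML i.
  apply: le_lt_trans (mulmx_dist_le (MC i) (fun j => ltW (wv j)) (ML i)) _.
  rewrite [ltRHS](splitr r); apply: ltr_leD => //.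
  by apply: le_trans tV; rewrite ler_wpM2r.
apply: (@ball_triangle _ _ (proj_pt (nzv Lv0))).
  apply: ball_sym; apply: near_ball; apply: (lt_r _ 0); rewrite ?(ltW t0) //.
    move=> i j; rewrite -[L i j](subKr (P (phi s) i j)).
    apply: le_trans (qnormD _ _) _; rewrite qnormN.
    have t1 : t <= 1 by rewrite ge_min lexx.
    apply: lerD; first exact: le_trans (PB _ _ _) (ler_norm _).
    exact: le_trans (sL i j) t1.
  by move=> i j; rewrite subrr qnorm0.
apply: near_ball; apply: (lt_r _ t) => // i j.
exact: le_trans (PB _ _ _) BC.
Qed.

End Normality.

(** * Uniform convergence along convergent sequences *)

Section ConvergentSequences.

(** A neighbourhood of [l] takes care of all but finitely many terms, which are treated one by
    one. *)
Lemma compact_cvg_seq (X : topologicalType) (p : nat -> X) (l : X) :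
  p s @[s --> \oo] --> l -> compact (l |` range p).
Proof.
move=> pl; apply/compact_near_coveringP => J F Q FF cov.
have [[A B] /= [Al FB] ABQ] := cov l (or_introl erefl).
have [T _ TA] := pl A Al.
have near_init : \forall i \near F, forall s : 'I_T, Q i (p s).
  apply: filter_forall => s.
  have ps : (l |` range p) (p s) by right; exists s.
  have [[A' B'] /= [A's FB'] ABQ'] := cov _ ps.
  by apply: filterS FB' => i B'i; apply: (ABQ' (p s, i)); split=> //; exact: nbhs_singleton.
apply: filterS (filterI FB near_init) => i [Bi Qi] x [->|[s _ <-]].
  by apply: (ABQ (l, i)); split=> //=; exact: nbhs_singleton.
have [sT|Ts] := ltnP s T; first exact: Qi (Ordinal sT).
by apply: (ABQ (p s, i)); split=> //=; exact: TA.
Qed.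

(** Used to refute normality: two sequences with the same limit must have images with the same
    limit. *)
Lemma cvg_uniform_seq (R : realType) (X : pseudoMetricType R) (U : set X)
    (g : nat -> X -> X) (f : X -> X) (l : X) (p : nat -> X) :
  open U -> U l -> (forall s, continuous (g s)) ->
  (forall K : set X, K `<=` U -> compact K -> {uniform K, g s @[s --> \oo] --> f}) ->
  p s @[s --> \oo] --> l -> (fun s => g s (p s)) s @[s --> \oo] --> f l.
Proof.
move=> oU Ul gc gf pl.
have nU : \forall s \near \oo, U (p s) by apply: pl; exact: open_nbhs_nbhs.
(* The finitely many terms outside [U] are replaced by [l], so that the compact set lies in [U]. *)
pose q s := if pselect (U (p s)) then p s else l.
have qE : \forall s \near \oo, p s = q s.
  by apply: filterS nU => s Us; rewrite /q; case: pselect.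
have qU s : U (q s) by rewrite /q; case: pselect.
have ql : q s @[s --> \oo] --> l.
  by apply: cvg_trans pl; apply: near_eq_cvg; apply: filterS qE => s.
have KU : l |` range q `<=` U by move=> x [->|[s _ <-]].
have {}gf := gf _ KU (compact_cvg_seq ql).
suff : (fun s => g s (q s)) s @[s --> \oo] --> f l.
  by apply: cvg_trans; apply: near_eq_cvg; apply: filterS qE => s ->.
apply/cvg_ballP => e e0.
have e4 : 0 < e / 4 by rewrite divr_gt0.
have unif : \forall s \near \oo, forall x, (l |` range q) x -> ball (f x) (e / 4) (g s x).
  apply: (gf [set h | forall x, (l |` range q) x -> ball (f x) (e / 4) (h x)]).
  apply/uniform_nbhs; exists [set xy | ball xy.1 (e / 4) xy.2]; split=> //.
  by rewrite -entourage_ballE; exists (e / 4).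
have [T _ TK] := unif.
have gT : (fun s => g T (q s)) s @[s --> \oo] --> g T l.
  by apply: (cvg_comp q (g T) ql); exact: gc.
move/cvg_ballP/(_ _ e4) : gT => gT.
apply: filterS (filterI unif gT) => s [us gs].
(* The way from [f l] to [g s (q s)] leads through [g T l], [g T (q s)] and [f (q s)], with [T]
   fixed. *)
have -> : e = e / 4 + e / 4 + e / 4 + e / 4 by field.
have Kq : (l |` range q) (q s) by right; exists s.
apply: ball_triangle (us _ Kq).
apply: ball_triangle (ball_sym (TK T (leqnn _) _ Kq)).
apply: ball_triangle gs.
exact: (TK T (leqnn _) l (or_introl erefl)).
Qed.

End ConvergentSequences.

(** * Spreading of points near a contracted point *)

Section NonNormality.
Variables (R : realType) (N : nat).
Local Notation H := (quat R).
Local Notation PS := (Defs.proj R N).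

(** Under this condition [proj_map P] never takes its default value. *)
Definition injective_mx (P : 'M[H]_N) := forall v : 'cV_N, v != 0 -> P *m v != 0.

Lemma proj_map_nzv (P : 'M[H]_N) (v : nzvec R N) (Pv0 : P *m val v != 0) :
  proj_map P (proj_pt v) = proj_pt (nzv Pv0).
Proof. exact: proj_map_pt. Qed.

Lemma continuous_proj_map (P : 'M[H]_N) : injective_mx P ->
  continuous (proj_map P : PS -> PS).
Proof.
move=> Pinj p; rewrite -[p]repr_proj_pt; set v := repr p => S.
rewrite (proj_map_nzv (Pinj _ (valP v))) => /nbhs_proj_pt[r r0 rS].
pose B := \sum_i \sum_j qnorm (P i j).
have PB i j : qnorm (P i j) <= B.
  rewrite /B (bigD1 i) //= (bigD1 j) //= -addrA lerDl addr_ge0 ?sumr_ge0 // => ? _.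
    exact: qnorm_ge0.
  by apply: sumr_ge0 => ? _; exact: qnorm_ge0.
have B0 : 0 <= B by do 2 (apply: sumr_ge0 => ? _); exact: qnorm_ge0.
have BN0 : 0 <= B * N%:R by rewrite mulr_ge0.
apply/nbhs_proj_pt; exists (r / (B * N%:R + 1)).
  by rewrite divr_gt0 // ltr_wpDl.
move=> w wv; rewrite /= (proj_map_nzv (Pinj _ (valP w))); apply: rS => i /=.
apply: (@le_lt_trans _ _ (B * (N%:R * (r / (B * N%:R + 1))))).
  have := @mulmx_dist_le R N P P (val v) (val w) B (r / (B * N%:R + 1)) 0 i.
  rewrite mul0r addr0; apply => // j; first exact/ltW/wv.
  by rewrite subrr qnorm0.
by rewrite mulrA mulrCA gtr_pMr // ltr_pdivrMr ?mul1r ?ltrDl // ltr_wpDl.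
Qed.

(** The left side is the [(i, i)] entry of the projector onto the line of [w]; the same entry for
    [v] is 0. *)
Lemma proj_dist_ge (v w : nzvec R N) i : val v i 0 = 0 ->
  qnormsq (val w i 0) / vnormsq (val w) <= proj_dist (proj_pt v) (proj_pt w).
Proof.
move=> vi0; rewrite /proj_dist (bigD1 i) //= (bigD1 i) //= -addrA.
apply: (@le_trans _ _ (qnorm (projector (proj_pt v) i i - projector (proj_pt w) i i))).
  rewrite !projectorE vi0 !mul0r sub0r qnormN mulqconj -qrealM qnorm_real.
  exact: ler_norm.
rewrite lerDl addr_ge0 ?sumr_ge0 // => ? _; first exact: qnorm_ge0.
by apply: sumr_ge0 => ? _; exact: qnorm_ge0.
Qed.

(** Early terms [w s] may be zero; [insubd] replaces these by [z] to obtain a total sequence of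
    points. *)
Lemma cvg_proj_pt (z : nzvec R N) (w : nat -> 'cV[H]_N) (x : nat -> R) :
  (forall s i, qnorm (w s i 0 - val z i 0) <= x s) -> x s @[s --> \oo] --> (0 : R) ->
  (\forall s \near \oo, w s != 0) /\
  proj_pt (insubd z (w s)) @[s --> \oo] --> (proj_pt z : PS).
Proof.
move=> wz x0.
have small e : 0 < e -> \forall s \near \oo, x s < e.
  move=> e0; have /cvgrPdist_lt/(_ e e0) := x0; apply: filterS => s.
  by rewrite sub0r normrN; apply: le_lt_trans; exact: ler_norm.
have [i0 zi0] : exists i, val z i 0 != 0.
  apply/existsP; apply: contraT; rewrite negb_exists => /forallP zi.
  have /eqP := valP z; case; apply/matrixP => i j; rewrite ord1 [RHS]mxE.
  by apply/eqP; have := zi i; rewrite negbK.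
have w0 : \forall s \near \oo, w s != 0.
  have : 0 < qnorm (val z i0 0) by rewrite lt_neqAle eq_sym qnorm_eq0 zi0 qnorm_ge0.
  move=> /small; apply: filterS => s xs; apply/eqP => ws.
  have := le_lt_trans (wz s i0) xs.
  by rewrite ws [X in X - _]mxE sub0r qnormN ltxx.
split=> // S /nbhs_proj_pt[e e0 eS].
apply: filterS (filterI w0 (small e e0)) => s [ws xs]; apply: eS => i.
rewrite insubdK //; exact: le_lt_trans (wz s i) xs.
Qed.

(* Near z, the maps P s send some points to points with a vanishing coordinate
   and others, equally near, to points where this coordinate dominates. *)
Lemma spread_points (P : 'M[H]_N) (z u : 'cV[H]_N) (d B y : R) :
  0 < d -> d <= vnormsq (P *m u) <= B -> 0 < y -> vnormsq (P *m z) <= y ^+ 2 ->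
  exists (w w' : 'cV[H]_N) (i : 'I_N),
  [/\ forall j, qnorm (w j 0 - z j 0) <= (\sum_l qnorm (u l 0)) * (N%:R / d + 2) * y,
      forall j, qnorm (w' j 0 - z j 0) <= (\sum_l qnorm (u l 0)) * (N%:R / d + 2) * y,
      (P *m w) i 0 = 0 &
      d / N%:R / (2 + 4 * B * (N%:R / d + 1)) <=
        qnormsq ((P *m w') i 0) / vnormsq (P *m w')].
Proof.
move=> d0 /andP[dPu PuB] y0 Pzy.
have Pu0 : P *m u != 0 by rewrite -vnormsq_gt0 (lt_le_trans d0).
have [i iPu] := exists_large_coord Pu0.
have N0 : 0 < N%:R :> R by rewrite ltr0n; apply: leq_ltn_trans (ltn_ord i).
set c := (P *m u) i 0 in iPu.
have cd : d / N%:R <= qnormsq c.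
  by rewrite ler_pdivrMr // mulrC; exact: le_trans dPu iPu.
have dN0 : 0 < d / N%:R by rewrite divr_gt0.
have c0 : c != 0 by rewrite -qnormsq_eq0 gt_eqF // (lt_le_trans dN0).
have Nd0 : 0 < N%:R / d by rewrite divr_gt0.
(* Chosen so that coordinate [i] of [P (z + u x)] vanishes. *)
pose x := - (c^-1 * (P *m z) i 0).
have xy2 : qnormsq x <= N%:R / d * y ^+ 2.
  have -> : qnormsq x = qnormsq c^-1 * qnormsq ((P *m z) i 0).
    by rewrite -qnormsqM -!sqr_qnorm qnormN.
  apply: ler_pM; rewrite ?qnormsq_ge0 //.
    rewrite -sqr_qnorm qnormV // exprVn sqr_qnorm -[N%:R / d]invf_div lef_pV2 ?posrE //.
    exact: lt_le_trans cd.
  exact: le_trans (le_qnormsq_vnormsq _ _) Pzy.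
have xy : qnorm x <= (N%:R / d + 1) * y.
  rewrite -(@ler_pXn2r _ 2) ?nnegrE ?qnorm_ge0 ?mulr_ge0 ?addr_ge0 ?(ltW Nd0) ?(ltW y0) //.
  rewrite sqr_qnorm exprMn; apply: le_trans xy2 _.
  rewrite ler_wpM2r ?sqr_ge0 // sqrrD1; have := sqr_ge0 (N%:R / d); move: Nd0; lra.
pose U := \sum_l qnorm (u l 0).
have uU j : qnorm (u j 0) <= U.
  by rewrite /U (bigD1 j) //= lerDl sumr_ge0 // => ? _; exact: qnorm_ge0.
have U0 : 0 <= U by apply: sumr_ge0 => ? _; exact: qnorm_ge0.
have dist (a : H) j : qnorm a <= (N%:R / d + 2) * y ->
    qnorm ((z + u *m a%:M) j 0 - z j 0) <= U * (N%:R / d + 2) * y.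
  move=> ay; rewrite mxE scaler_mxE addrAC subrr add0r qnormM -mulrA.
  by apply: ler_pM; rewrite ?qnorm_ge0.
(* Adding the real number [y] to [x] turns this coordinate into [c y], while the distance to [z]
   stays of order [y]. *)
exists (z + u *m x%:M), (z + u *m (x + qreal y)%:M), i; split.
- move=> j; apply: dist; apply: le_trans xy _.
  by rewrite ler_pM2r //; lra.
- move=> j; apply: dist; apply: le_trans (qnormD _ _) _.
  rewrite qnorm_real gtr0_norm //.
  have -> : (N%:R / d + 2) * y = (N%:R / d + 1) * y + y by ring.
  by rewrite lerD2r.
- by rewrite mulmxDr mulmxA mxE scaler_mxE -/c /x mulrN mulrA divqq // mul1r subrr.
have -> : (P *m (z + u *m (x + qreal y)%:M)) i 0 = c * qreal y.
  rewrite mulmxDr mulmxA mxE scaler_mxE -/c /x mulrDr mulrN mulrA divqq // mul1r.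
  by rewrite addrA subrr add0r.
rewrite qnormsqM qnormsq_qreal.
(* The squared norm of the second image is at most [C y^2], so [y] cancels from the quotient and the
   lower bound does not depend on it. *)
set C := 2 + _.
have B0 : 0 <= B by apply: le_trans PuB; exact: vnormsq_ge0.
have C0 : 0 < C by rewrite ltr_wpDr // !mulr_ge0 // addr_ge0 // ltW.
have y2 : 0 < y ^+ 2 by rewrite exprn_gt0.
set w' := P *m _.
have w'0 : 0 < vnormsq w'.
  apply: lt_le_trans (le_qnormsq_vnormsq w' i).
  rewrite /w' mulmxDr mulmxA mxE scaler_mxE -/c /x mulrDr mulrN mulrA divqq // mul1r.
  rewrite addrA subrr add0r qnormsqM qnormsq_qreal mulr_gt0 //.
  exact: lt_le_trans cd.
rewrite ler_pdivlMr // -[leLHS]mulrA; apply: ler_pM; rewrite ?(ltW dN0) //.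
  by rewrite mulr_ge0 ?invr_ge0 ?(ltW C0) ?(ltW w'0).
rewrite ler_pdivrMl // /w' mulmxDr mulmxA; apply: le_trans (vnormsqD_le _ _) _.
rewrite vnormsqZ.
have xy3 : qnormsq (x + qreal y) <= 2 * (N%:R / d * y ^+ 2) + 2 * y ^+ 2.
  apply: le_trans (qnormsqD_le _ _) _; rewrite qnormsq_qreal lerD2r.
  by rewrite ler_wpM2l.
have prod : vnormsq (P *m u) * qnormsq (x + qreal y) <=
    B * (2 * (N%:R / d * y ^+ 2) + 2 * y ^+ 2).
  by apply: ler_pM; rewrite ?vnormsq_ge0 ?qnormsq_ge0.
have -> : C * y ^+ 2 = 2 * y ^+ 2 + 2 * (B * (2 * (N%:R / d * y ^+ 2) + 2 * y ^+ 2)).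
  by rewrite /C; move: (N%:R / d) => t; ring.
by apply: lerD; rewrite ler_wpM2l.
Qed.

End NonNormality.

(** * A contracted point is not a point of normality *)

Section Contraction.
Variables (R : realType) (N : nat).
Local Notation H := (quat R).
Local Notation PS := (Defs.proj R N).

(** The two sequences given by [spread_points] both tend to [z], so a limit map [f] would bring
    their images together at [f z]; but by [proj_dist_ge] these images stay at distance at least
    [k]. *)
Lemma not_normal_of_contraction (P : nat -> 'M[H]_N) (F : set (PS -> PS)) (U : set PS)
    (z : nzvec R N) (u : 'cV[H]_N) (d B : R) :
  (forall s, injective_mx (P s)) -> (forall s, F (proj_map (P s))) ->
  0 < d -> (forall s, d <= vnormsq (P s *m u) <= B) ->
  vnormsq (P s *m val z) @[s --> \oo] --> (0 : R) ->
  open U -> U (proj_pt z) -> ~ normal_family U F.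
Proof.
move=> Pinj FP d0 Pu Pz oU Uz /(_ _ FP)[phi [f [inc gf]]].
(* The second summand keeps [y s] positive even when the first one vanishes. *)
pose y s := Num.sqrt (vnormsq (P (phi s) *m val z)) + s.+1%:R^-1.
have y_cvg : y s @[s --> \oo] --> (0 : R).
  rewrite -[0 in X in _ --> X]addr0; apply: cvgD; last exact: cvg_harmonic.
  rewrite -[0 in X in _ --> X]sqrtr0.
  apply: (cvg_comp _ (Num.sqrt : R -> R) (cvg_subseq inc Pz)).
  exact: sqrt_continuous.
have y0 s : 0 < y s by rewrite ltr_wpDl ?sqrtr_ge0 // invr_gt0.
have yz s : vnormsq (P (phi s) *m val z) <= y s ^+ 2.
  rewrite -[leLHS](sqr_sqrtr (vnormsq_ge0 _)).
  by rewrite lerXn2r ?nnegrE ?sqrtr_ge0 ?(ltW (y0 s)) // lerDl invr_ge0.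
pose K := (\sum_l qnorm (u l 0)) * (N%:R / d + 2).
pose k := d / N%:R / (2 + 4 * B * (N%:R / d + 1)).
pose spread s (x : 'cV[H]_N * 'cV[H]_N * 'I_N) :=
  [/\ forall j, qnorm (x.1.1 j 0 - val z j 0) <= K * y s,
      forall j, qnorm (x.1.2 j 0 - val z j 0) <= K * y s,
      (P (phi s) *m x.1.1) x.2 0 = 0 &
      k <= qnormsq ((P (phi s) *m x.1.2) x.2 0) / vnormsq (P (phi s) *m x.1.2)].
have [x xP] : {x : nat -> 'cV[H]_N * 'cV[H]_N * 'I_N & forall s, spread s (x s)}.
  apply: (@choice _ _ spread) => s.
  by have [w [w' [i []]]] := spread_points d0 (Pu (phi s)) (y0 s) (yz s); exists (w, w', i).
have Ky : K * y s @[s --> \oo] --> (0 : R).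
  by rewrite -[0 in X in _ --> X](mulr0 K); apply: cvgM y_cvg; exact: cvg_cst.
have wz s j : qnorm ((x s).1.1 j 0 - val z j 0) <= K * y s by case: (xP s).
have w'z s j : qnorm ((x s).1.2 j 0 - val z j 0) <= K * y s by case: (xP s).
have [w0 w_cvg] := cvg_proj_pt wz Ky.
have [w'0 w'_cvg] := cvg_proj_pt w'z Ky.
have Pc s : continuous (proj_map (P (phi s)) : PS -> PS).
  exact: continuous_proj_map.
have lim_w := cvg_uniform_seq oU Uz Pc gf w_cvg.
have lim_w' := cvg_uniform_seq oU Uz Pc gf w'_cvg.
have N0 : 0 < N%:R :> R by rewrite ltr0n; exact: leq_ltn_trans (leq0n _) (ltn_ord (x 0%N).2).
have B0 : 0 <= B by have /andP[dPu PuB] := Pu 0%N; exact: le_trans (ltW d0) (le_trans dPu PuB).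
have k0 : 0 < k.
  by rewrite !divr_gt0 // ltr_wpDr // !mulr_ge0 // addr_ge0 // divr_ge0 // ltW.
have k2 : 0 < k / 2 by rewrite divr_gt0.
move/cvg_ballP/(_ _ k2) : lim_w => lim_w.
move/cvg_ballP/(_ _ k2) : lim_w' => lim_w'.
have [s _ /(_ s (leqnn s)) [[ws0 w's0] [bw bw']]] :=
  filterI (filterI w0 w'0) (filterI lim_w lim_w').
have := ball_triangle (ball_sym bw) bw'; rewrite -splitr.
have Pws0 : P (phi s) *m val (insubd z (x s).1.1) != 0 by apply: Pinj; exact: (valP (insubd z (x s).1.1)).
have Pw's0 : P (phi s) *m val (insubd z (x s).1.2) != 0 by apply: Pinj; exact: (valP (insubd z (x s).1.2)).
rewrite (proj_map_nzv Pws0) (proj_map_nzv Pw's0) ballEmdist /=.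
move=> dist.
have {}dist : proj_dist (proj_pt (nzv Pws0)) (proj_pt (nzv Pw's0)) < k := dist.
have [_ _ Pw_i Pw'_i] := xP s.
have Pw_i' : val (nzv Pws0) (x s).2 0 = 0 by rewrite /= insubdK.
have := proj_dist_ge (nzv Pw's0) Pw_i'.
move: dist; set D := proj_dist _ _ => Dk; rewrite /= insubdK // => /(le_trans Pw'_i).
by rewrite leNgt Dk.
Qed.

End Contraction.

(** * Growth functions of matrix powers and the equicontinuity region of a cyclic group *)

Section Growth.
Variables (R : realType) (N : nat).
Local Notation H := (quat R).
Local Notation PS := (Defs.proj R N).
Implicit Types (M P : 'M[H]_N) (c : nat -> R) (G : 'cV[H]_N -> R) (v w : 'cV[H]_N).

Definition growth M c G :=
  (forall t, 0 < c t) /\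
  forall v, c t * vnormsq (M ^+ t *m v) @[t --> \oo] --> G v.

Definition null_set G : set 'cV[H]_N := [set v | G v = 0].

Section GrowthFunction.
Variables (M : 'M[H]_N) (c : nat -> R) (G : 'cV[H]_N -> R).
Hypothesis MG : growth M c G.

Lemma growth_fun_ge0 v : 0 <= G v.
Proof.
case: MG => c0 /(_ v) cv; apply: (cvgr_to_ge cv).
by apply: nearW => t; rewrite mulr_ge0 ?vnormsq_ge0 // ltW.
Qed.

Lemma growth_funZ v (a : H) : G (v *m a%:M) = G v * qnormsq a.
Proof.
case: MG => c0 cv; apply: (cvg_unique (@Rhausdorff R) (cv _)).
have -> : (fun t => c t * vnormsq (M ^+ t *m (v *m a%:M))) =
    (fun t => c t * vnormsq (M ^+ t *m v) * qnormsq a).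
  by apply/funext => t; rewrite mulmxA vnormsqZ mulrA.
by apply: cvgM; [exact: cv | exact: cvg_cst].
Qed.

Lemma growth_fun0 : G 0 = 0.
Proof.
have := growth_funZ 0 0; rewrite mul0mx => ->.
by rewrite (_ : qnormsq 0 = 0) ?mulr0 //; apply/eqP; rewrite qnormsq_eq0.
Qed.

Lemma growth_funD_le v w : G (v + w) <= 2 * G v + 2 * G w.
Proof.
case: MG => c0 cv.
have cvs : 2 * (c t * vnormsq (M ^+ t *m v)) + 2 * (c t * vnormsq (M ^+ t *m w))
    @[t --> \oo] --> 2 * G v + 2 * G w.
  by apply: cvgD; apply: cvgM; [exact: cvg_cst|exact: cv|exact: cvg_cst|exact: cv].
apply: (ler_cvg_to (cv (v + w)) cvs).
apply: nearW => t /=.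
rewrite !(mulrCA 2) -mulrDr ler_pM2l // mulmxDr; exact: vnormsqD_le.
Qed.

(** Closure under sums follows from the weak triangle inequality because [G] is nonnegative. *)
Lemma right_subspace_null : right_subspace (null_set G).
Proof.
split=> [|v w v0 w0|v a v0]; first exact: growth_fun0.
  apply/eqP; rewrite eq_le growth_fun_ge0 andbT.
  by apply: le_trans (growth_funD_le v w) _; rewrite v0 w0 !mulr0 addr0.
by rewrite /null_set /= growth_funZ v0 mul0r.
Qed.

End GrowthFunction.

Lemma projectivizationP (W : set 'cV[H]_N) (v : nzvec R N) : right_subspace W ->
  projectivization W (proj_pt v) <-> W (val v).
Proof.
move=> [_ _ WZ]; split=> [[w Ww /esym/proj_ptP[a _ ->]]|Wv]; last by exists v.
exact: WZ.
Qed.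

(** A real scalar is central, so scaling on the left amounts to scaling representatives on the
    right. *)
Lemma proj_map_qreal_scale (x : R) P : x != 0 -> injective_mx P ->
  proj_map (qreal x *: P) = proj_map P :> (PS -> PS).
Proof.
move=> x0 Pinj; apply/funext => p; rewrite -[p]repr_proj_pt; set v := repr p.
have Pv0 := Pinj _ (valP v).
have scaleE w : qreal x *: w = w *m (qreal x)%:M.
  by apply/matrixP => i j; rewrite ord1 scaler_mxE mxE qreal_comm.
have xr0 : qreal x != 0 by rewrite -qnorm_eq0 qnorm_real normr_eq0.
have xv0 : qreal x *: P *m val v != 0.
  by rewrite -scalemxAl -vnormsq_gt0 vnormsqZl mulr_gt0 ?vnormsq_gt0 //
    lt_neqAle eq_sym qnormsq_eq0 xr0 qnormsq_ge0.
rewrite (proj_map_nzv Pv0) (proj_map_nzv xv0); apply/proj_ptP; exists (qreal x) => //=.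
by rewrite -scaleE scalemxAl.
Qed.

Lemma injective_mxM P M : injective_mx P -> injective_mx M -> injective_mx (P * M).
Proof. by move=> Pi Mi v /Mi/Pi; rewrite mulmxA. Qed.

Lemma injective_mxX M t : injective_mx M -> injective_mx (M ^+ t).
Proof.
move=> Mi; elim: t => [|t IH]; last by rewrite exprS; exact: injective_mxM.
by move=> v v0; rewrite expr0 mul1mx.
Qed.

Lemma injective_mx_left_inv M M' : M' * M = 1 -> injective_mx M.
Proof.
move=> M1 v; apply: contra_neq => Mv.
by rewrite -[v]mul1mx -[1%:M]M1 -mulmxA Mv mulmx0.
Qed.

Lemma proj_mapM P M : injective_mx P -> injective_mx M ->
  proj_map (P * M) = proj_map P \o proj_map M :> (PS -> PS).
Proof.
move=> Pi Mi; apply/funext => p; rewrite -[p]repr_proj_pt /=; set v := repr p.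
have Mv0 := Mi _ (valP v); have PMv0 := injective_mxM Pi Mi (valP v).
rewrite (proj_map_nzv Mv0) (proj_map_nzv PMv0).
by apply/esym/proj_map_pt; rewrite /= mulmxA.
Qed.

Lemma proj_map1 : proj_map 1 = id :> (PS -> PS).
Proof.
apply/funext => p; rewrite -[p]repr_proj_pt.
by apply: proj_map_pt; rewrite mul1mx.
Qed.

Lemma iter_proj_map M t : injective_mx M ->
  iter t (proj_map M) = proj_map (M ^+ t) :> (PS -> PS).
Proof.
move=> Mi; elim: t => [|t IH]; first by rewrite expr0 proj_map1.
by rewrite exprS proj_mapM //=; [rewrite -IH|exact: injective_mxX].
Qed.

(** In [cyclic_group] a negative power is any two-sided inverse of an iterate; inverses are unique,
    so it is a power of [M']. *)
Lemma cyclic_group_proj_map M M' : M * M' = 1 -> M' * M = 1 ->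
  cyclic_group (proj_map M) =
  [set h | exists t : nat, h = proj_map (M ^+ t) \/ h = proj_map (M' ^+ t)].
Proof.
move=> M1 M1'.
have Mi := injective_mx_left_inv M1'; have M'i := injective_mx_left_inv M1.
have cancelX (A B : 'M[H]_N) t : B * A = 1 -> B ^+ t * A ^+ t = 1.
  move=> BA; elim: t => [|t IH]; first by rewrite !expr0 mulr1.
  by rewrite exprSr exprS mulrA -[_ * B * A]mulrA BA mulr1.
have MM' t : cancel (proj_map (M ^+ t)) (proj_map (M' ^+ t) : PS -> PS).
  move=> p; have := proj_mapM (injective_mxX t M'i) (injective_mxX t Mi).
  by rewrite (cancelX M M') // proj_map1 => /(congr1 (@^~ p)).
have M'M t : cancel (proj_map (M' ^+ t)) (proj_map (M ^+ t) : PS -> PS).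
  move=> p; have := proj_mapM (injective_mxX t Mi) (injective_mxX t M'i).
  by rewrite (cancelX M' M) // proj_map1 => /(congr1 (@^~ p)).
apply/seteqP; split=> h [t]; rewrite ?iter_proj_map //.
  case=> [->|[hM Mh]]; exists t; [by left|right].
  by apply/funext => p; rewrite -{2}[p]hM MM'.
case=> ->; exists t; rewrite iter_proj_map //; first by left.
by right; split.
Qed.

(** From some index on the terms are at least [l / 2]; the finitely many earlier ones are
    positive. *)
Lemma positive_lower_bound (a : nat -> R) (l : R) : (forall t, 0 < a t) -> 0 < l ->
  a t @[t --> \oo] --> l -> exists2 d : R, 0 < d & forall t, d <= a t.
Proof.
move=> a0 l0 al; have l2 : 0 < l / 2 by rewrite divr_gt0.
have [T _ Ta] : \forall t \near \oo, l / 2 <= a t.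
  have /cvgrPdist_le/(_ _ l2) := al; apply: filterS => t.
  by rewrite ler_norml => /andP[_]; lra.
exists (\big[Num.min/l / 2]_(t < T) a t).
  by elim/big_ind: _ => // x y x0 y0; rewrite lt_min x0.
move=> t; have [tT|Tt] := ltnP t T; first exact: (bigmin_le_cond _ _ (isT : xpredT (Ordinal tT))).
exact: le_trans (bigmin_le_id _ _ _ _) (Ta _ Tt).
Qed.

(** The square root appears because [growth] rescales squared norms. *)
Definition scaled M c t : 'M[H]_N := qreal (Num.sqrt (c t)) *: M ^+ t.

Lemma vnormsq_scaled M c t v : (forall t, 0 < c t) ->
  vnormsq (scaled M c t *m v) = c t * vnormsq (M ^+ t *m v).
Proof.
by move=> c0; rewrite -scalemxAl vnormsqZl qnormsq_qreal sqr_sqrtr // ltW.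
Qed.

Lemma proj_map_scaled M c t : (forall t, 0 < c t) -> injective_mx M ->
  proj_map (scaled M c t) = proj_map (M ^+ t) :> (PS -> PS).
Proof.
move=> c0 Mi; apply: proj_map_qreal_scale; last exact: injective_mxX.
by rewrite sqrtr_eq0 -ltNge.
Qed.

(** Column [j] is the image of a basis vector, and its squared norms converge, hence are bounded. *)
Lemma scaled_bounded M c G : growth M c G ->
  exists B, forall t i j, qnorm (scaled M c t i j) <= B.
Proof.
move=> [c0 cv].
have col_bound j : {b : R | forall t i, qnorm (scaled M c t i j) <= b}.
  apply: cid.
  have /cvgP/cvg_seq_bounded/pinfty_ex_gt0[b b0 /= bP] := cv (delta_mx j 0).
  exists (Num.sqrt b) => t i.
  have := bP t I; rewrite -vnormsq_scaled // ger0_norm ?vnormsq_ge0 //.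
  by move=> /(qnorm_le_sqrt i); rewrite -colE mxE.
exists (\sum_j `|sval (col_bound j)|) => t i j.
rewrite (bigD1 j) //=; apply: le_trans (svalP (col_bound j) t i) _.
by apply: le_trans (ler_norm _) _; rewrite lerDl sumr_ge0.
Qed.

Lemma not_equicontinuous_null M c G (F : set (PS -> PS)) (z : nzvec R N) u :
  injective_mx M -> growth M c G -> (forall t, F (proj_map (M ^+ t))) ->
  G u != 0 -> G (val z) = 0 -> ~ equicontinuity_region F (proj_pt z).
Proof.
move=> Mi MG FM Gu Gz [U [oU Uz]]; have [c0 cv] := MG.
have Gu0 : 0 < G u by rewrite lt_neqAle eq_sym Gu (growth_fun_ge0 MG).
have Gu2 : 0 < G u / 2 by rewrite divr_gt0.
have [T _ Tu] : \forall t \near \oo, G u / 2 <= c t * vnormsq (M ^+ t *m u) <= 2 * G u.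
  have /cvgrPdist_le/(_ _ Gu2) := cv u; apply: filterS => t.
  by rewrite ler_norml => /andP[? ?]; apply/andP; split; lra.
(* The shift by [T] makes the two bounds at [u] hold for every index. *)
apply: (@not_normal_of_contraction _ _ (fun s => scaled M c (s + T)) F U z u _ (2 * G u) _ _ Gu2)
  => // [s|s|s|].
- move=> v v0; rewrite -vnormsq_gt0 vnormsq_scaled // mulr_gt0 // vnormsq_gt0.
  exact: injective_mxX.
- by rewrite proj_map_scaled.
- by rewrite vnormsq_scaled //; apply: Tu; rewrite /= leq_addl.
- rewrite -Gz; have := cv (val z); rewrite -(cvg_shiftn T) /=.
  by under eq_fun do rewrite -vnormsq_scaled //.
Qed.

(** Zeros of [G] and [G'] are excluded by [not_equicontinuous_null] for [M] and for [M']. At any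
    other point all rescaled powers, forward and backward, stay away from 0; this persists on an
    open set, where [normal_of_lower_bound] applies. *)
Lemma equicontinuity_cyclic M M' c c' G G' :
  M * M' = 1 -> M' * M = 1 -> growth M c G -> growth M' c' G' ->
  (exists u, G u != 0) -> (exists u, G' u != 0) ->
  equicontinuity_region (cyclic_group (proj_map M)) =
  ~` (projectivization (null_set G) `|` projectivization (null_set G')).
Proof.
move=> M1 M1' MG MG' [u Gu] [u' Gu'].
have Mi := injective_mx_left_inv M1'; have M'i := injective_mx_left_inv M1.
have [[c0 cv] [c'0 cv']] := (MG, MG').
rewrite (cyclic_group_proj_map M1 M1'); set F := (X in equicontinuity_region X).
have FM t : F (proj_map (M ^+ t)) by exists t; left.
have FM' t : F (proj_map (M' ^+ t)) by exists t; right.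
apply/seteqP; split=> p.
  move=> + [] [z Gz zp]; rewrite -zp.
    exact: (not_equicontinuous_null Mi MG FM Gu Gz).
  exact: (not_equicontinuous_null M'i MG' FM' Gu' Gz).
move=> /not_orP[]; rewrite -[p]repr_proj_pt; set v := repr p => Gv Gv'.
have [B PB] := scaled_bounded MG; have [B' PB'] := scaled_bounded MG'.
pose F0 := [set P | exists t, P = scaled M c t \/ P = scaled M' c' t].
pose C := `|B| + `|B'|.
have F0C P : F0 P -> forall i j, qnorm (P i j) <= C.
  move=> [t [->|->]] i j; have := (ler_norm B, ler_norm B', normr_ge0 B, normr_ge0 B').
    by have := PB t i j; rewrite /C; move=> ? [[[? ?] ?] ?]; lra.
  by have := PB' t i j; rewrite /C; move=> ? [[[? ?] ?] ?]; lra.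
have C0 : 0 <= C by rewrite addr_ge0.
pose low (w : 'cV[H]_N) := exists2 d : R, 0 < d & forall P, F0 P -> d <= vnormsq (P *m w).
have lowZ (w : 'cV[H]_N) (a : H) : a != 0 -> low w -> low (w *m a%:M).
  move=> a0 [d d0 dP]; exists (d * qnormsq a) => [|P /dP].
    by rewrite mulr_gt0 // lt_neqAle eq_sym qnormsq_eq0 a0 qnormsq_ge0.
  by rewrite mulmxA vnormsqZ; apply: ler_wpM2r; exact: qnormsq_ge0.
pose U : set PS := [set q | exists2 w : nzvec R N, q = proj_pt w & low (val w)].
have UP (w : nzvec R N) : U (proj_pt w) -> low (val w).
  by move=> [x /proj_ptP[a a0 ->] lx]; exact: lowZ.
exists U; split.
(* If [P] moves the difference of [w] and [x] to squared norm at most [d / 4], then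
   [d <= 2 |P x|^2 + d / 2], so [d / 4] is a lower bound at [x]. *)
- apply/Defs.proj_open => w /UP[d d0 dP].
  pose K := N%:R * (C * N%:R) ^+ 2.
  have K0 : 0 <= K by rewrite mulr_ge0 ?sqr_ge0.
  have K1 : 0 < K + 1 by rewrite ltr_wpDl.
  pose e := Num.min 1 (d / 4 / (K + 1)).
  have e0 : 0 < e by rewrite lt_min ltr01 !divr_gt0.
  exists e => // x xw; exists x => //; exists (d / 4) => [|P F0P]; first by rewrite divr_gt0.
  have := dP _ F0P; have -> : val w = val x + (val w - val x) by rewrite addrC subrK.
  rewrite mulmxDr => /le_trans/(_ (vnormsqD_le _ _)).
  have : vnormsq (P *m (val w - val x)) <= d / 4.
    apply: (@le_trans _ _ (N%:R * (C * (N%:R * e)) ^+ 2)).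
      apply: vnormsq_le => i; apply: le_trans (mulmx_coord_le _ (F0C _ F0P i)) _.
      apply: ler_wpM2l => //; apply: (@le_trans _ _ (\sum_(j < N) e)); last first.
        by rewrite sumr_const card_ord mulr_natl.
      by apply: ler_sum => j _; rewrite !mxE qnormB_sym ltW.
    have -> : N%:R * (C * (N%:R * e)) ^+ 2 = K * e * e by rewrite /K; ring.
    have e1 : e <= 1 by rewrite ge_min lexx.
    apply: (@le_trans _ _ (K * e)).
      by rewrite ler_piMr // mulr_ge0 // ltW.
    apply: (@le_trans _ _ (K * (d / 4 / (K + 1)))).
      by rewrite ler_wpM2l // ge_min lexx orbT.
    by rewrite mulrCA ler_piMr ?divr_ge0 ?(ltW d0) // ler_pdivrMr // mul1r lerDl.
  by lra.
- exists v => //.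
  have G0 : 0 < G (val v).
    rewrite lt_neqAle (growth_fun_ge0 MG) andbT eq_sym; apply/eqP => Gv0.
    by apply: Gv; exists v.
  have G0' : 0 < G' (val v).
    rewrite lt_neqAle (growth_fun_ge0 MG') andbT eq_sym; apply/eqP => Gv0.
    by apply: Gv'; exists v.
  have pos t : 0 < c t * vnormsq (M ^+ t *m val v).
    by rewrite mulr_gt0 // vnormsq_gt0; apply: injective_mxX => //; exact: (valP v).
  have pos' t : 0 < c' t * vnormsq (M' ^+ t *m val v).
    by rewrite mulr_gt0 // vnormsq_gt0; apply: injective_mxX => //; exact: (valP v).
  have [d d0 dP] := positive_lower_bound pos G0 (cv _).
  have [d' d'0 dP'] := positive_lower_bound pos' G0' (cv' _).
  exists (Num.min d d') => [|P [t [->|->]]]; first by rewrite lt_min d0.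
    by rewrite vnormsq_scaled // ge_min dP.
  by rewrite vnormsq_scaled // ge_min dP' orbT.
have norm0 : normal_family U [set proj_map P | P in F0].
  by apply: (normal_of_lower_bound F0C) => w; exact: UP.
move=> g gF; apply: norm0 => l; have [t [->|->]] := gF l.
  by exists (scaled M c t); [exists t; left|rewrite proj_map_scaled].
by exists (scaled M' c' t); [exists t; right|rewrite proj_map_scaled].
Qed.

End Growth.

(** * The embedding of the complex numbers into the quaternions *)

Section Qcplx.
Variable R : realType.
Local Notation C := R[i].
Local Notation H := (quat R).

(** With [qcplx] a ring morphism, identities between complex matrices carry over to quaternionic
    ones through [map_mx]. *)
Lemma qcplx_zmod_morphism : zmod_morphism (@qcplx R).
Proof. by move=> x y; congr Quat; rewrite ?subrr. Qed.
HB.instance Definition _ :=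
  GRing.isZmodMorphism.Build C H (@qcplx R) qcplx_zmod_morphism.

Lemma qcplx_monoid_morphism : monoid_morphism (@qcplx R).
Proof.
split=> // x y; apply/eqP; rewrite -subr_eq0 -qnormsq_eq0.
case: x y => [a b] [c d]; rewrite /qnormsq /=; apply/eqP; ring.
Qed.
HB.instance Definition _ :=
  GRing.isMonoidMorphism.Build C H (@qcplx R) qcplx_monoid_morphism.

Lemma normr_qnorm (x : C) : `|x| = (qnorm (qcplx x))%:C%C.
Proof.
by case: x => a b; rewrite normc_def /qnorm /qnormsq /= expr0n /= !addr0.
Qed.

Lemma qnorm_qcplx1 : qnorm (qcplx (1 : C)) = 1.
Proof. by rewrite [LHS](qnorm_real 1) normr1. Qed.

Lemma qnorm_qcplxX (x : C) t : qnorm (qcplx (x ^+ t)) = qnorm (qcplx x) ^+ t.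
Proof.
elim: t => [|t IH]; first by rewrite !expr0 qnorm_qcplx1.
by rewrite !exprS rmorphM qnormM IH.
Qed.

Lemma qnorm_qcplx_nat n : qnorm (qcplx (n%:R : C)) = n%:R.
Proof.
have -> : n%:R = (n%:R : R)%:C%C :> C by rewrite raddfMn.
by rewrite [LHS]qnorm_real ger0_norm.
Qed.

Lemma qnorm_qcplxV (x : C) : x != 0 -> qnorm (qcplx x^-1) = (qnorm (qcplx x))^-1.
Proof.
move=> x0; have qx0 : qnorm (qcplx x) != 0.
  by rewrite qnorm_eq0; apply: contra_neq x0 => -[].
apply: (mulfI qx0); rewrite -qnormM -rmorphM divff // divff //.
exact: qnorm_qcplx1.
Qed.

End Qcplx.

Lemma cvg_sumr (R : realType) (I : Type) (r : seq I) (P : pred I)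
    (u : I -> nat -> R) (l : I -> R) :
  (forall i, P i -> u i t @[t --> \oo] --> l i) ->
  \sum_(i <- r | P i) u i t @[t --> \oo] --> \sum_(i <- r | P i) l i.
Proof.
move=> ul; elim: r => [|i r IH].
  by under eq_fun do rewrite big_nil; rewrite big_nil; exact: cvg_cst.
under eq_fun do rewrite big_cons; rewrite big_cons.
by case: ifPn => // Pi; apply: cvgD => //; exact: ul.
Qed.

(** * Block diagonal matrices *)

Section Blocks.
Variables (R : realType) (k : nat) (p : 'I_k -> nat).
Local Notation H := (quat R).
Local Notation n := (\sum_(i < k) p i)%N.

Lemma vnormsq_submxcol (v : 'cV[H]_n) :
  vnormsq v = \sum_(i < k) vnormsq (submxcol v i).
Proof.
rewrite /vnormsq sig_big_dep /= (reindex _ (tagnat.sig_bij_on)) /=.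
by apply: eq_bigr => i _; rewrite mxE /= tagnat.sig2K.
Qed.

Lemma submxcol_mxdiag_mul (B : forall i, 'M[H]_(p i)) (v : 'cV[H]_n) i :
  submxcol (\mxdiag_i B i *m v) i = B i *m submxcol v i.
Proof. by rewrite -{1}[v]submxcolK mul_mxdiag_mxcol mxcolK. Qed.

Lemma submxcol_mxdiagX (B : forall i, 'M[H]_(p i)) (v : 'cV[H]_n) t i :
  submxcol ((\mxdiag_i B i) ^+ t *m v) i = B i ^+ t *m submxcol v i.
Proof.
elim: t => [|t IH]; first by rewrite !expr0 !mul1mx.
by rewrite !exprS -!mulmxA submxcol_mxdiag_mul IH.
Qed.

Lemma mxdiag_mul (B B' : forall i, 'M[H]_(p i)) :
  \mxdiag_i B i *m \mxdiag_i B' i = \mxdiag_i (B i *m B' i).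
Proof.
rewrite {2}/mxdiag mul_mxdiag_mxblock /mxdiag; apply/eq_mxblock => i j.
by case: eqVneq => [->|_]; rewrite ?mulmx0 // !conform_mx_id.
Qed.

Lemma mxdiag_inv (B B' : forall i, 'M[H]_(p i)) : (forall i, B i * B' i = 1) ->
  \mxdiag_i B i * \mxdiag_i B' i = 1.
Proof.
move=> BB; rewrite -[RHS](mxdiagZ (p_ := p)) -[LHS]/(mulmx _ _) mxdiag_mul.
by apply: eq_mxdiag => i; exact: BB.
Qed.

(** Squared norms add up over the blocks. The weight [c] is common to all, so a block that grows
    more slowly enters with a zero function. *)
Lemma growth_mxdiag (B : forall i, 'M[H]_(p i)) (c : nat -> R)
    (G : forall i, 'cV[H]_(p i) -> R) :
  (forall t, 0 < c t) ->
  (forall i v, c t * vnormsq (B i ^+ t *m v) @[t --> \oo] --> G i v) ->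
  growth (\mxdiag_i B i) c (fun v => \sum_i G i (submxcol v i)).
Proof.
move=> c0 cv; split=> // v.
under eq_fun do rewrite vnormsq_submxcol mulr_sumr.
apply: cvg_sumr => i _.
by under eq_fun do rewrite submxcol_mxdiagX; exact: cv.
Qed.

End Blocks.

(** * Powers of Jordan blocks as Toeplitz matrices *)

Section Toeplitz.
Variable R : realType.
Local Notation C := R[i].
Local Notation H := (quat R).
Variable r : nat.

(** The power series with coefficients [a d], evaluated at the nilpotent shift. *)
Definition toeplitz (a : nat -> C) : 'M[C]_r :=
  \matrix_(i, j) if (i <= j)%N then a (j - i)%N else 0.

Lemma eq_toeplitz (a b : nat -> C) : a =1 b -> toeplitz a = toeplitz b.
Proof. by move=> ab; apply/matrixP => i j; rewrite !mxE ab. Qed.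

(** The coefficients of [mu + X]. *)
Definition jordan_coef (mu : C) d : C := if d is 0 then mu else (d == 1)%:R.

Lemma jordan_toeplitz (mu : C) :
  jordan_block mu r = map_mx (@qcplx R) (toeplitz (jordan_coef mu)).
Proof.
apply/matrixP => i j; rewrite !mxE -val_eqE /=.
case: (ltngtP i j) => [ij|ji|->]; last by rewrite subnn.
  case dE: (j - i)%N => [|d]; first by move: dE => /eqP; rewrite subn_eq0 leqNgt ij.
  have -> : (i.+1 == j) = (d.+1 == 1)%N.
    by rewrite -dE -(subnKC (ltnW ij)) addKn -addn1 eqn_add2l eq_sym.
  by rewrite /= rmorph_nat.
by rewrite rmorph0 gtn_eqF // ltnW.
Qed.

Lemma toeplitz_jordan_mul (mu : C) (b : nat -> C) :
  toeplitz (jordan_coef mu) *m toeplitz b =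
  toeplitz (fun d => mu * b d + if d is d'.+1 then b d' else 0).
Proof.
have -> : toeplitz (jordan_coef mu) = mu%:M + \matrix_(i, j) (i.+1 == j)%:R.
  apply/matrixP => i j; rewrite !mxE -val_eqE /=.
  case: (ltngtP i j) => [ij|ji|->]; last by rewrite subnn mulr1n gtn_eqF // addr0.
    case dE: (j - i)%N => [|d]; first by move: dE => /eqP; rewrite subn_eq0 leqNgt ij.
    have -> : (i.+1 == j) = (d.+1 == 1)%N.
      by rewrite -dE -(subnKC (ltnW ij)) addKn -addn1 eqn_add2l eq_sym.
    by rewrite /= mulr0n add0r.
  by rewrite gtn_eqF ?addr0 // ltnW.
rewrite mulmxDl mul_scalar_mx; apply/matrixP => i j; rewrite !mxE.
have -> : \sum_k (\matrix_(i, j) (i.+1 == j)%:R) i k * toeplitz b k j =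
    (if (i < j)%N then b (j - i.+1)%N else 0) :> C.
  (* In the last row the shift is zero, and there [i < j] is impossible as well. *)
  have [ir|ri] := ltnP i.+1 r.
    rewrite (bigD1 (Ordinal ir)) //= !mxE eqxx mul1r big1 ?addr0 // => l li.
    by rewrite !mxE; case: eqP => [il|]; rewrite ?mul0r //; case/eqP: li; apply: val_inj.
  rewrite big1 => [|l _]; last first.
    by rewrite !mxE gtn_eqF ?mul0r // (leq_trans (ltn_ord l) ri).
  case: ifP => // ij; have := leq_ltn_trans ij (ltn_ord j).
  by rewrite ltnNge ri.
case: (ltngtP i j) => [ij|ji|->]; rewrite ?mulr0 ?addr0 //; last by rewrite subnn addr0.
case dE: (j - i)%N => [|d]; first by move: dE => /eqP; rewrite subn_eq0 leqNgt ij.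
by rewrite subnS dE.
Qed.

(** The coefficients of [(mu + X)^t]; for [d > t] the binomial is 0, whatever the truncated
    exponent. *)
Definition jordan_pow_coef (mu : C) t d : C := 'C(t, d)%:R * mu ^+ (t - d).

(* (-1)^d 'C(t + d - 1, d) is the binomial coefficient of -t over d; at t = d = 0 the
   truncated predecessor still gives the right value 1. *)
Definition jordan_inv_coef (mu : C) t d : C :=
  (-1) ^+ d * 'C((t + d).-1, d)%:R * (mu ^+ (t + d))^-1.

Lemma toeplitz1 (a : nat -> C) : a 0 = 1 -> (forall d, a d.+1 = 0) -> toeplitz a = 1%:M.
Proof.
move=> a0 a1; apply/matrixP => i j; rewrite !mxE -val_eqE /=.
case: (ltngtP i j) => [ij||->]; rewrite ?subnn ?a0 //.
case dE: (j - i)%N => [|d]; last by rewrite a1.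
by move: dE => /eqP; rewrite subn_eq0 leqNgt ij.
Qed.

Lemma jordan_pow0 (mu : C) : toeplitz (jordan_pow_coef mu 0) = 1%:M.
Proof.
apply: toeplitz1 => [|d]; rewrite /jordan_pow_coef ?bin0 ?mul1r //.
by rewrite bin0n mul0r.
Qed.

Lemma jordan_powS (mu : C) t :
  toeplitz (jordan_coef mu) *m toeplitz (jordan_pow_coef mu t) =
  toeplitz (jordan_pow_coef mu t.+1).
Proof.
rewrite toeplitz_jordan_mul; apply: eq_toeplitz => -[|d]; rewrite /jordan_pow_coef.
  by rewrite !bin0 !subn0 !mul1r addr0 exprS.
rewrite binS natrD mulrDl subSS; congr (_ + _).
have [dt|td] := ltnP d t; first by rewrite mulrCA -exprS subnSK.
by rewrite bin_small // !mul0r mulr0.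
Qed.

Lemma jordan_inv0 (mu : C) : toeplitz (jordan_inv_coef mu 0) = 1%:M.
Proof.
apply: toeplitz1 => [|d]; rewrite /jordan_inv_coef.
  by rewrite bin0 !expr0 !mul1r invr1.
by rewrite add0n /= bin_small // mulr0 mul0r.
Qed.

(** Multiplying the series of [(mu + X)^-(t+1)] by [mu + X] is, on coefficients, the Pascal rule
    with alternating signs. *)
Lemma jordan_invS (mu : C) t : mu != 0 ->
  toeplitz (jordan_coef mu) *m toeplitz (jordan_inv_coef mu t.+1) =
  toeplitz (jordan_inv_coef mu t).
Proof.
move=> mu0; rewrite toeplitz_jordan_mul; apply: eq_toeplitz => -[|d]; rewrite /jordan_inv_coef.
  by rewrite !addn0 !bin0 addr0 !expr0 !mul1r exprS invfM mulrA divff // mul1r.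
have e1 : mu * (mu ^+ (t.+1 + d.+1))^-1 = (mu ^+ (t + d.+1))^-1.
  by rewrite addSn exprS invfM mulrA divff // mul1r.
have e2 : (t.+1 + d = t + d.+1)%N by rewrite addSnnS.
rewrite (mulrCA mu) e1 e2 -mulrDl; congr (_ * _).
rewrite addSn addnS /= binS natrD exprS; ring.
Qed.

End Toeplitz.

(** * Asymptotics of Toeplitz matrices with binomial coefficients *)

Section ToeplitzGrowth.
Variable R : realType.
Local Notation C := R[i].
Local Notation H := (quat R).

Lemma cvg_succV_mul (x : R) : x / t.+1%:R @[t --> \oo] --> (0 : R).
Proof.
rewrite -[0 in X in _ --> X](mulr0 x); apply: cvgM; first exact: cvg_cst.
exact: cvg_harmonic.
Qed.

(** One induction serves positive and negative powers: a step in [d] multiplies by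
    [s t d / (d + 1)], and [s t d / (t + 1)] tends to 1. The form of [s] is only asked for large
    [t], because [t - d] is truncated. *)
Lemma bin_step_cvg (b : nat -> nat -> nat) (s : nat -> nat -> nat) (x : nat -> R) :
  (forall t, b t 0 = 1)%N -> (forall t d, d.+1 * b t d.+1 = s t d * b t d)%N ->
  (forall d, \forall t \near \oo, (s t d)%:R = t.+1%:R + x d :> R) ->
  forall d, (b t d)%:R / t.+1%:R ^+ d @[t --> \oo] --> (d`!%:R^-1 : R).
Proof.
move=> b0 bS sx; elim=> [|d IH].
  by under eq_fun do rewrite b0 expr0 divr1; rewrite fact0 invr1; exact: cvg_cst.
have -> : (fun t => (b t d.+1)%:R / t.+1%:R ^+ d.+1 : R) =
    (fun t => (d.+1%:R)^-1 * ((b t d)%:R / t.+1%:R ^+ d * ((s t d)%:R / t.+1%:R))).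
  apply/funext => t.
  have -> : (b t d.+1)%:R = (d.+1%:R)^-1 * ((s t d)%:R * (b t d)%:R) :> R.
    by rewrite -natrM -bS natrM mulrA mulVf ?mul1r // pnatr_eq0.
  by rewrite exprS invfM; ring.
rewrite factS natrM invfM; apply: cvgM; first exact: cvg_cst.
rewrite -[X in _ --> X]mulr1; apply: cvgM => //.
have : 1 + x d / t.+1%:R @[t --> \oo] --> (1 : R).
  rewrite -[X in _ --> X]addr0; apply: cvgD; first exact: cvg_cst.
  exact: cvg_succV_mul.
apply: cvg_trans; apply: near_eq_cvg; apply: filterS (sx d) => t ->.
by rewrite mulrDl divff // pnatr_eq0.
Qed.

Lemma bin_cvg d : 'C(t, d)%:R / t.+1%:R ^+ d @[t --> \oo] --> (d`!%:R^-1 : R).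
Proof.
apply: (@bin_step_cvg (fun t d => 'C(t, d)) (fun t d => t - d)%N (fun d => - d.+1%:R)).
- by move=> t; rewrite bin0.
- by move=> t e; rewrite mul_bin_left.
- move=> e; exists e => // t /= et; rewrite natrB // -(natr1 t) -(natr1 e); ring.
Qed.

Lemma bin_rev_cvg d :
  'C((t + d).-1, d)%:R / t.+1%:R ^+ d @[t --> \oo] --> (d`!%:R^-1 : R).
Proof.
apply: (@bin_step_cvg (fun t d => 'C((t + d).-1, d)) (fun t d => t + d)%N (fun d => d%:R - 1)).
- by move=> t; rewrite bin0.
- by move=> t e; rewrite addnS /= mul_bin_diag.
- by move=> e; apply: nearW => t; rewrite natrD -(natr1 t); ring.
Qed.

Lemma lower_degree_cvg (b : nat -> R) (l : R) d q : (d < q)%N ->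
  b t / t.+1%:R ^+ d @[t --> \oo] --> l -> b t / t.+1%:R ^+ q @[t --> \oo] --> (0 : R).
Proof.
move=> dq bl.
have -> : (fun t => b t / t.+1%:R ^+ q) =
    (fun t => b t / t.+1%:R ^+ d * (t.+1%:R^-1) ^+ (q - d).-1 * t.+1%:R^-1).
  apply/funext => t; rewrite -{1}(subnKC (ltnW dq)) exprD invfM.
  rewrite -!mulrA; congr (_ * (_ * _)).
  by rewrite -exprSr prednK ?subn_gt0 // exprVn.
rewrite -[0 in X in _ --> X](mulr0 (l * 0 ^+ (q - d).-1)).
apply: cvgM; last exact: cvg_harmonic.
apply: cvgM => //; elim: (q - d).-1 => [|n IH].
  by under eq_fun do rewrite expr0; rewrite expr0; exact: cvg_cst.
under eq_fun do rewrite exprS; rewrite exprS; apply: cvgM => //.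
exact: cvg_harmonic.
Qed.

(* Only i = 0, j = q can contribute, and only when r = q + 1; the sum vanishes when
   r <= q. *)
Definition toeplitz_growth_fun (q r : nat) (v : 'cV[H]_r) : R :=
  \sum_(i < r) (\sum_(j < r | j == (i + q)%N :> nat) q`!%:R^-1 * qnorm (v j 0)) ^+ 2.

(** In row [i] the coordinate [v j] has a coefficient of order [t^(j - i)]. As [r <= q + 1], no
    order exceeds [q], and after division by [t^q] only [j = i + q] survives. *)
Lemma toeplitz_cvg (a : nat -> nat -> C) q r (v : 'cV[H]_r) : (r <= q.+1)%N ->
  (forall d, qnorm (qcplx (a t d)) / t.+1%:R ^+ d @[t --> \oo] --> (d`!%:R^-1 : R)) ->
  (t.+1%:R ^+ q ^+ 2)^-1 * vnormsq (map_mx (@qcplx R) (toeplitz r (a t)) *m v)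
    @[t --> \oo] --> toeplitz_growth_fun q v.
Proof.
move=> rq a_cvg; under eq_fun do rewrite /vnormsq mulr_sumr.
apply: cvg_sumr => i _.
pose T t : R := t.+1%:R ^+ q.
have T0 t : 0 < T t by rewrite exprn_gt0.
pose x t := (map_mx (@qcplx R) (toeplitz r (a t)) *m v) i 0.
suff xc : qnorm (x t) / T t @[t --> \oo] -->
    \sum_(j < r | j == (i + q)%N :> nat) q`!%:R^-1 * qnorm (v j 0).
  under eq_fun do rewrite -sqr_qnorm mulrC -exprVn -exprMn expr2.
  by rewrite expr2; exact: cvgM.
(* [m] is the leading term, a sum of at most one summand, and [e] bounds all the others. *)
pose m t := \sum_(j < r | j == (i + q)%N :> nat) qnorm (qcplx (a t q)) / T t * qnorm (v j 0).
pose e t := \sum_(j < r | j != (i + q)%N :> nat)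
  (if (i <= j)%N then qnorm (qcplx (a t (j - i)%N)) / T t else 0) * qnorm (v j 0).
have mc : m t @[t --> \oo] --> \sum_(j < r | j == (i + q)%N :> nat) q`!%:R^-1 * qnorm (v j 0).
  by apply: cvg_sumr => j _; apply: cvgM; [exact: a_cvg|exact: cvg_cst].
have ec : e t @[t --> \oo] --> (0 : R).
  have -> : 0 = \sum_(j < r | j != (i + q)%N :> nat) 0 * qnorm (v j 0) :> R.
    by rewrite big1 // => j _; rewrite mul0r.
  apply: cvg_sumr => j jiq; apply: cvgM; last exact: cvg_cst.
  case: leqP => ij; last exact: cvg_cst.
  apply: lower_degree_cvg (a_cvg _).
  have jq : (j <= q)%N by rewrite -ltnS (leq_trans (ltn_ord j)).
  rewrite ltn_neqAle (leq_trans (leq_subr _ _) jq) andbT.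
  by apply: contra_neq jiq => <-; rewrite subnKC.
have bound t : `|qnorm (x t) / T t - m t| <= e t.
  pose main := \sum_(j < r | j == (i + q)%N :> nat) qcplx (a t q) * v j 0.
  pose rest := \sum_(j < r | j != (i + q)%N :> nat)
    (if (i <= j)%N then qcplx (a t (j - i)%N) else 0) * v j 0.
  have xE : x t = main + rest.
    rewrite /x mxE (bigID (fun j : 'I_r => j == (i + q)%N :> nat)) /=; congr (_ + _).
      by apply: eq_bigr => j /eqP jE; rewrite !mxE jE leq_addr addKn.
    by apply: eq_bigr => j _; rewrite !mxE; case: leqP => // _; rewrite rmorph0.
  have mainE : qnorm main / T t = m t.
    rewrite /main /m; have [iq|iq] := ltnP (i + q)%N r.
      rewrite !(big_pred1 (Ordinal iq)) //; first by rewrite qnormM; ring.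
    have no (j : 'I_r) : (j == (i + q)%N :> nat) = false.
      by rewrite ltn_eqF // (leq_trans (ltn_ord j)).
    by rewrite !big_pred0 ?qnorm0 ?mul0r.
  have restE : qnorm rest / T t <= e t.
    rewrite ler_pdivrMr // /e mulr_suml /rest -big_filter.
    apply: le_trans (qnorm_sum _ _) _; rewrite big_filter.
    apply: ler_sum => j _; rewrite qnormM; case: leqP => _.
      by rewrite mulrAC divfK ?gt_eqF.
    by rewrite qnorm0 !mul0r.
  have qmain : `|qnorm (x t) - qnorm main| <= qnorm rest.
    rewrite xE ler_norml; apply/andP; split; last first.
      by rewrite lerBlDl; exact: qnormD.
    have := qnormD (main + rest) (- rest); rewrite addrK qnormN; lra.
  rewrite -mainE -mulrBl normrM (ger0_norm (x := (T t)^-1)) ?invr_ge0 ?(ltW (T0 t)) //.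
  by apply: le_trans restE; rewrite ler_pM2r // invr_gt0.
apply: (@squeeze_cvgr _ _ _ _ (fun t => m t - e t) (fun t => m t + e t)).
- by apply: nearW => t; have := bound t; rewrite ler_norml => /andP[? ?]; apply/andP; split; lra.
- by rewrite -[X in _ --> X]subr0; exact: cvgB.
- by rewrite -[X in _ --> X]addr0; exact: cvgD.
Qed.

Lemma toeplitz_growth_fun_ge0 q r (v : 'cV[H]_r) : 0 <= toeplitz_growth_fun q v.
Proof. by apply: sumr_ge0 => i _; exact: sqr_ge0. Qed.

Lemma toeplitz_growth_fun_gt0 q : 0 < toeplitz_growth_fun q (const_mx 1 : 'cV[H]_q.+1).
Proof.
rewrite /toeplitz_growth_fun (bigD1 ord0) //=.
rewrite ltr_wpDr ?sumr_ge0 // => [i _|]; first exact: sqr_ge0.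
rewrite (big_pred1 ord_max) => [|j]; last by rewrite /= add0n -val_eqE.
rewrite mxE exprn_gt0 // mulr_gt0 ?invr_gt0 ?ltr0n ?fact_gt0 //.
by rewrite -qreal1 qnorm_real normr1.
Qed.

End ToeplitzGrowth.

(** * Growth of Jordan blocks with eigenvalue of modulus 1 *)

Section JordanGrowth.
Variable R : realType.
Local Notation C := R[i].
Local Notation H := (quat R).

Lemma map_mxX_qcplx r (X : 'M[C]_r) t :
  map_mx (@qcplx R) X ^+ t = map_mx (@qcplx R) (iter t (mulmx X) 1%:M).
Proof.
elim: t => [|t IH]; first by rewrite expr0 /= map_mx1.
by rewrite exprS /= map_mxM -IH.
Qed.

Definition jordan_inv (mu : C) r : 'M[H]_r :=
  map_mx (@qcplx R) (toeplitz r (jordan_inv_coef mu 1)).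

Variables (mu : C) (r : nat).
Hypothesis mu1 : qnorm (qcplx mu) = 1.

Lemma mu_neq0 : mu != 0.
Proof.
apply/eqP => m0; have := mu1.
by rewrite m0 rmorph0 qnorm0 => /esym/eqP; rewrite oner_eq0.
Qed.

Lemma jordan_mul_inv : jordan_block mu r * jordan_inv mu r = 1.
Proof.
rewrite jordan_toeplitz -[LHS]map_mxM jordan_invS ?mu_neq0 //.
by rewrite jordan_inv0 map_mx1.
Qed.

(** Proved over the complex numbers, where a one-sided inverse of a square matrix is two-sided. *)
Lemma toeplitz_inv_mul :
  toeplitz r (jordan_inv_coef mu 1) *m toeplitz r (jordan_coef mu) = 1%:M.
Proof. by apply: mulmx1C; rewrite jordan_invS ?mu_neq0 // jordan_inv0. Qed.

Lemma jordan_inv_mul : jordan_inv mu r * jordan_block mu r = 1.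
Proof. by rewrite jordan_toeplitz -[LHS]map_mxM toeplitz_inv_mul map_mx1. Qed.

Lemma jordan_blockX t :
  jordan_block mu r ^+ t = map_mx (@qcplx R) (toeplitz r (jordan_pow_coef mu t)).
Proof.
rewrite jordan_toeplitz map_mxX_qcplx; congr map_mx.
by elim: t => [|t IH] /=; rewrite ?jordan_pow0 // IH jordan_powS.
Qed.

Lemma jordan_invX t :
  jordan_inv mu r ^+ t = map_mx (@qcplx R) (toeplitz r (jordan_inv_coef mu t)).
Proof.
rewrite map_mxX_qcplx; congr map_mx.
elim: t => [|t IH] /=; first by rewrite jordan_inv0.
by rewrite IH -(jordan_invS r t mu_neq0) mulmxA toeplitz_inv_mul mul1mx.
Qed.

Lemma jordan_growth q (v : 'cV[H]_r) : (r <= q.+1)%N ->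
  (t.+1%:R ^+ q ^+ 2)^-1 * vnormsq (jordan_block mu r ^+ t *m v)
    @[t --> \oo] --> toeplitz_growth_fun q v.
Proof.
move=> rq; under eq_fun do rewrite jordan_blockX.
apply: toeplitz_cvg => // d; under eq_fun do
  rewrite /jordan_pow_coef rmorphM qnormM qnorm_qcplx_nat qnorm_qcplxX mu1 expr1n mulr1.
exact: bin_cvg.
Qed.

(** Signs and powers of [mu] have modulus 1, and the binomials of negative powers have the same
    leading order as those of positive ones; hence the same limit as in [jordan_growth]. *)
Lemma jordan_inv_growth q (v : 'cV[H]_r) : (r <= q.+1)%N ->
  (t.+1%:R ^+ q ^+ 2)^-1 * vnormsq (jordan_inv mu r ^+ t *m v)
    @[t --> \oo] --> toeplitz_growth_fun q v.
Proof.
move=> rq; under eq_fun do rewrite jordan_invX.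
have qN1 : qnorm (qcplx (-1 : C)) = 1.
  by rewrite rmorphN1 qnormN -qreal1 qnorm_real normr1.
apply: toeplitz_cvg => // d; under eq_fun do
  rewrite /jordan_inv_coef !rmorphM !qnormM qnorm_qcplx_nat qnorm_qcplxX qN1 expr1n mul1r
    qnorm_qcplxV ?expf_neq0 ?mu_neq0 // qnorm_qcplxX mu1 expr1n invr1 mulr1.
exact: bin_rev_cvg.
Qed.

End JordanGrowth.

(** * Growth of parabolic blocks and of their scaled direct sums *)

Section ParabolicGrowth.
Variable R : realType.
Local Notation C := R[i].
Local Notation H := (quat R).

(** Complex scalars are not central among quaternionic matrices; this condition lets the powers of
    [lambda A] factor. *)
Definition commutes_qcplx r (A : 'M[H]_r) :=
  forall c : C, (qcplx c)%:M * A = A * (qcplx c)%:M.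

Lemma commutes_qcplx_inv r (A A' : 'M[H]_r) : A * A' = 1 -> A' * A = 1 ->
  commutes_qcplx A -> commutes_qcplx A'.
Proof.
move=> AA' A'A cA c.
by rewrite -[LHS]mul1r -A'A -mulrA (mulrA A) -cA -mulrA AA' mulr1.
Qed.

Lemma commutes_qcplx_jordan (mu : C) r : commutes_qcplx (jordan_block mu r).
Proof.
move=> c; rewrite jordan_toeplitz -map_scalar_mx -[LHS]map_mxM -[RHS]map_mxM.
by rewrite scalar_mxC.
Qed.

Definition poly_weight (q t : nat) : R := (t.+1%:R ^+ q ^+ 2)^-1.

Lemma poly_weight_gt0 q t : 0 < poly_weight q t.
Proof. by rewrite invr_gt0 !exprn_gt0. Qed.

Section JordanForm.
Variables (s : nat) (r : 'I_s -> nat) (mu : 'I_s -> C).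
Local Notation n := (\sum_(l < s) r l)%N.
Local Notation A := (\mxdiag_(l < s) jordan_block (mu l) (r l)).

(** The eigenvector is the first basis vector of block [l]. Through it, the eigenvalue condition on
    a parabolic block yields modulus 1 for every [mu l]. *)
Lemma right_eigenvalue_jordan l : (0 < r l)%N -> right_eigenvalue A (qcplx (mu l)).
Proof.
move=> rl; pose b i (a : 'I_(r i)) : H := ((i == l) && (a == 0 :> nat))%:R.
exists (\mxcol_i \col_a b i a).
  apply/eqP => /(congr1 (fun v => submxcol v l (Ordinal rl) 0)) /=.
  by rewrite mxcolK submxcol0 !mxE /b !eqxx /= => /eqP; rewrite oner_eq0.
rewrite mul_mxdiag_mxcol; apply/mxcolP => i; rewrite mxcolK -submxcol_mul mxcolK.
apply/matrixP => a j; rewrite ord1 scaler_mxE !mxE.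
under eq_bigr do rewrite !mxE /b.
rewrite /b; case: eqVneq => [il|_] /=; last first.
  by rewrite big1 ?mul0r // => ? _; rewrite mulr0.
have ri : (0 < r i)%N by rewrite il.
rewrite (bigD1 (Ordinal ri)) //= mulr1 big1 ?addr0 => [|c c0]; last first.
  have [c0'|_] := eqVneq (c : nat) 0%N; last by rewrite mulr0.
  by case/eqP: c0; apply: val_inj.
rewrite -val_eqE /=; case: eqP => [_|_]; first by rewrite mul1r il.
by rewrite mul0r.
Qed.

(** Without any Jordan block the matrix would be empty, hence diagonalizable. *)
Lemma exists_largest_block : ~ diagonalizable_quat A -> exists l, forall i, (r i <= r l)%N.
Proof.
move=> nd; case: s r mu nd => [|s'] r' mu' nd; last first.
  by exists [arg max_(i > ord0) r' i]%N => i; case: arg_maxnP => // l _; apply.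
exfalso; apply: nd; exists 1%:M, 1%:M; rewrite !mulmx1 mul1mx; split=> //.
by apply/is_diag_mxP => i; have := ltn_ord i; rewrite [X in (_ < X)%N]big_ord0.
Qed.

End JordanForm.

(** The exponent [q] is one less than the size of the largest Jordan block. Smaller blocks
    contribute 0, and [A] shares [q] and [G] with its inverse. *)
Lemma parabolic_growth m (A : 'M[H]_m) : parabolic_block A ->
  exists (A' : 'M[H]_m) (q : nat) (G : 'cV[H]_m -> R),
  [/\ A * A' = 1 /\ A' * A = 1, growth A (poly_weight q) G,
      growth A' (poly_weight q) G, exists u, G u != 0 & commutes_qcplx A].
Proof.
move=> [[s [r [mu [e [r0 _ AE]]]]] nd eig].
subst m; rewrite castmx_id in AE; subst A.
have [l rl] := exists_largest_block nd.
have mu1 i : qnorm (qcplx (mu i)) = 1 by apply: eig; exact: (right_eigenvalue_jordan mu (r0 i)).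
have rq i : (r i <= (r l).-1.+1)%N by rewrite prednK.
exists (\mxdiag_i jordan_inv (mu i) (r i)), (r l).-1.
exists (fun v => \sum_i toeplitz_growth_fun (r l).-1 (submxcol v i)); split.
- by split; apply: mxdiag_inv => i; [exact: jordan_mul_inv|exact: jordan_inv_mul].
- by apply: (@growth_mxdiag R s r _ _ (fun i => @toeplitz_growth_fun R (r l).-1 (r i))) => [t|i v]; [exact: poly_weight_gt0|exact: jordan_growth].
- by apply: (@growth_mxdiag R s r _ _ (fun i => @toeplitz_growth_fun R (r l).-1 (r i))) => [t|i v]; [exact: poly_weight_gt0|exact: jordan_inv_growth].
(* The all-ones vector has a nonzero last coordinate in the largest block. *)
- exists (const_mx 1); rewrite gt_eqF // (bigD1 l) //=.
  have -> : submxcol (const_mx 1) l = const_mx 1 :> 'cV[H]_(r l).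
    by apply/matrixP => i j; rewrite !mxE.
  rewrite ltr_wpDr ?sumr_ge0 // => [i _|]; first exact: toeplitz_growth_fun_ge0.
  have rE : r l = (r l).-1.+1 by rewrite prednK.
  by move: (r l).-1 rE => q ->; exact: toeplitz_growth_fun_gt0.
- move=> c; rewrite -(mxdiagZ (p_ := r)) -[LHS]/(mulmx _ _) -[RHS]/(mulmx _ _) !mxdiag_mul.
  by apply: eq_mxdiag => i; exact: commutes_qcplx_jordan.
Qed.

Lemma geometric_poly_cvg (rho : R) k : 0 <= rho < 1 ->
  rho ^+ t * t.+1%:R ^+ k @[t --> \oo] --> (0 : R).
Proof.
elim: k rho => [|k IH] rho /andP[rho0 rho1].
  under eq_fun do rewrite expr0 mulr1.
  by apply: cvg_expr; rewrite ger0_norm.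
(* Half of the decay, one factor [s^t], absorbs one factor [t + 1]; the other half is left to the
   induction hypothesis. *)
pose s := Num.sqrt rho.
have s0 : 0 <= s by exact: sqrtr_ge0.
have s1 : s < 1 by rewrite -sqrtr1 ltr_sqrt.
have s1' : 0 < 1 - s by rewrite subr_gt0.
have sE : rho = s * s by rewrite -expr2 sqr_sqrtr.
(* Each of the [t + 1] terms of the geometric sum is at least [s^t]. *)
have bound t : t.+1%:R * s ^+ t * (1 - s) <= 1 - s ^+ t.+1.
  elim: t => [|t IHt]; first by rewrite expr0 expr1 !mul1r.
  have st : s * s ^+ t <= 1 by rewrite -exprS exprn_ile1 // ltW.
  have := ler_wpM2l s0 IHt; have := ler_wpM2r (ltW s1') st.
  rewrite -(natr1 t.+1) (exprS s t.+1) (exprS s t); lra.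
have bnd t : t.+1%:R * s ^+ t <= (1 - s)^-1.
  rewrite -[leRHS]mul1r ler_pdivlMr //; apply: le_trans (bound t) _.
  by rewrite gerBl exprn_ge0.
have c0 : (1 - s)^-1 * (s ^+ t * t.+1%:R ^+ k) @[t --> \oo] --> (0 : R).
  rewrite -[0 in X in _ --> X](mulr0 ((1 - s)^-1)); apply: cvgM; first exact: cvg_cst.
  by apply: IH; rewrite s0.
apply: (squeeze_cvgr _ (cvg_cst 0) c0); apply: nearW => t.
have -> : rho ^+ t * t.+1%:R ^+ k.+1 = t.+1%:R * s ^+ t * (s ^+ t * t.+1%:R ^+ k).
  by rewrite sE exprMn exprS; ring.
have p0 : 0 <= s ^+ t * t.+1%:R ^+ k by rewrite mulr_ge0 ?exprn_ge0.
by rewrite ler_wpM2r ?bnd // mulr_ge0 // mulr_ge0 ?exprn_ge0.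
Qed.

Lemma vnormsq_scaledX r (A : 'M[H]_r) (lam : C) t v : commutes_qcplx A ->
  vnormsq ((qcplx lam *: A) ^+ t *m v) = (qnorm (qcplx lam) ^+ 2) ^+ t * vnormsq (A ^+ t *m v).
Proof.
move=> cA; rewrite -mul_scalar_mx -[_ *m A]/(_ * A) exprMn_comm; last exact: cA.
have -> : (qcplx lam)%:M ^+ t = ((qcplx lam ^+ t)%:M : 'M[H]_r).
  elim: t => [|t IH]; first by rewrite !expr0.
  by rewrite !exprS IH -[LHS]scalar_mxM.
rewrite -[_ * _]/(_ *m _) mul_scalar_mx -scalemxAl vnormsqZl; congr (_ * _).
rewrite -sqr_qnorm -!exprM mulnC exprM; congr (_ ^+ 2).
elim: t => [|t IH]; first by rewrite !expr0 -qreal1 qnorm_real normr1.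
by rewrite !exprS qnormM IH.
Qed.

Section Dominated.
Variables (k : nat) (p : 'I_k -> nat) (lam : 'I_k -> C) (A : forall i, 'M[H]_(p i)).
Variables (q : 'I_k -> nat) (G : forall i, 'cV[H]_(p i) -> R) (l : 'I_k).

(** In the scale of block [l], any other block carries a factor [rho^t] with [rho < 1], which beats
    its polynomial growth. *)
Lemma dominated_growth :
  (forall i, growth (A i) (poly_weight (q i)) (@G i)) ->
  (forall i, commutes_qcplx (A i)) ->
  (forall i, i != l -> qnorm (qcplx (lam i)) < qnorm (qcplx (lam l))) -> lam l != 0 ->
  growth (\mxdiag_i (qcplx (lam i) *: A i))
    (fun t => poly_weight (q l) t / (qnorm (qcplx (lam l)) ^+ 2) ^+ t)
    (fun v => G (submxcol v l)).
Proof.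
move=> AG cA lamlt lam0.
have nl : 0 < qnorm (qcplx (lam l)).
  rewrite lt_neqAle qnorm_ge0 andbT eq_sym qnorm_eq0.
  by apply: contra_neq lam0 => -[].
have nl2 t : 0 < (qnorm (qcplx (lam l)) ^+ 2) ^+ t by rewrite !exprn_gt0.
pose G' i (w : 'cV[H]_(p i)) := if i == l then G w else 0.
have -> : (fun v => G (submxcol v l)) = (fun v => \sum_i G' i (submxcol v i)).
  apply/funext => v; rewrite (bigD1 l) //= /G' eqxx big1 ?addr0 // => i /negbTE.
  by move=> ->.
apply: (@growth_mxdiag R k p _ _ G') => [t|i v].
  by rewrite divr_gt0 // poly_weight_gt0.
rewrite /G'.
have [_ /(_ v) cv] := AG i.
have [il|il] := eqVneq i l.
  have -> // : (fun t => poly_weight (q l) t / (qnorm (qcplx (lam l)) ^+ 2) ^+ t *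
    vnormsq ((qcplx (lam i) *: A i) ^+ t *m v)) =
    (fun t => poly_weight (q i) t * vnormsq (A i ^+ t *m v)).
  (* The type of [A i] depends on [i], so the equality [i = l] is applied to [lam] and [q] only. *)
  have [lE qE] : lam i = lam l /\ q i = q l by rewrite il.
  apply/funext => t; rewrite vnormsq_scaledX // lE qE mulrA divfK //.
  by rewrite gt_eqF.
pose rho := (qnorm (qcplx (lam i)) / qnorm (qcplx (lam l))) ^+ 2.
have rho01 : 0 <= rho < 1.
  rewrite sqr_ge0 /= /rho expr_lt1 // ?divr_ge0 ?qnorm_ge0 //.
  by rewrite ltr_pdivrMr // mul1r lamlt.
(* Inserting the weight of block [i] leaves a convergent factor times one bounded by [rho^t] and a
   polynomial. *)
have -> : (fun t => poly_weight (q l) t / (qnorm (qcplx (lam l)) ^+ 2) ^+ t *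
    vnormsq ((qcplx (lam i) *: A i) ^+ t *m v)) =
    (fun t => (poly_weight (q l) t * (rho ^+ t * t.+1%:R ^+ (q i * 2))) *
       (poly_weight (q i) t * vnormsq (A i ^+ t *m v))).
  apply/funext => t; rewrite vnormsq_scaledX // /poly_weight /rho.
  have T0 : t.+1%:R ^+ (q i * 2) != 0 :> R by rewrite expf_neq0 // pnatr_eq0.
  have T1 : t.+1%:R ^+ (q l * 2) != 0 :> R by rewrite expf_neq0 // pnatr_eq0.
  rewrite !exprMn !exprVn -!exprM.
  have L0 : qnorm (qcplx (lam l)) ^+ t != 0 by rewrite expf_neq0 // gt_eqF.
  by field; rewrite T0 T1 L0.
rewrite -[0 in X in _ --> X](mul0r (G v)); apply: cvgM => //.
apply: (squeeze_cvgr _ (cvg_cst 0) (geometric_poly_cvg (q i * 2) rho01)).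
apply: nearW => t; have /andP[rho0 _] := rho01.
have p0 : 0 <= rho ^+ t * t.+1%:R ^+ (q i * 2).
  by apply: mulr_ge0; apply: exprn_ge0; rewrite ?ler0n.
rewrite mulr_ge0 ?(ltW (poly_weight_gt0 _ _)) //= ler_piMl // /poly_weight.
by rewrite invf_le1 ?exprn_gt0 // !exprn_ege1 // ler1n.
Qed.

End Dominated.
End ParabolicGrowth.

(** * Projective spans and linear subspaces *)

Section Spans.
Variables (R : realType) (N : nat).
Local Notation H := (quat R).
Local Notation PS := (Defs.proj R N).
Implicit Types (W : set 'cV[H]_N) (S : set PS).

Lemma right_subspace_sum W (I : Type) (r : seq I) (P : pred I) (F : I -> 'cV[H]_N) :
  right_subspace W -> (forall i, P i -> W (F i)) -> W (\sum_(i <- r | P i) F i).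
Proof. by move=> [W0 WD _]; exact: big_ind. Qed.

Lemma vec_sum_delta (v : 'cV[H]_N) : v = \sum_j delta_mx j 0 *m (v j 0)%:M.
Proof.
apply/matrixP => i j; rewrite ord1 summxE (bigD1 i) //= scaler_mxE mxE !eqxx mul1r.
rewrite big1 ?addr0 // => l li; rewrite scaler_mxE mxE eq_sym (negbTE li) mul0r //.
Qed.

Lemma proj_span_sub S W : right_subspace W -> S `<=` projectivization W ->
  proj_span S `<=` projectivization W.
Proof. by move=> sW SW p; apply; split=> //; exists W. Qed.

Lemma proj_span_pt S (v : nzvec R N) :
  (forall W, right_subspace W -> S `<=` projectivization W -> W (val v)) ->
  proj_span S (proj_pt v).
Proof. by move=> Sv P [SP [W sW PW]]; subst P; exists v => //; exact: Sv. Qed.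

Lemma projectivization_std W j : right_subspace W ->
  projectivization W (std_pt R j) <-> W (delta_mx j 0).
Proof. by move=> sW; rewrite projectivizationP. Qed.

End Spans.

(** * Spans of a subset of one block and the basis points of the others *)

Section BlockSpans.
Variables (R : realType) (k : nat) (p : 'I_k -> nat).
Local Notation H := (quat R).
Local Notation n := (\sum_(i < k) p i)%N.
Local Notation o i := (\sum_(l < k | (l < i)%N) p l)%N.
Local Notation e J := [set std_pt R j | j in [set j : 'I_n | J j]].
Local Notation block i := (tagnat.sig1 (p_ := p) i).

Lemma block_range (i : 'I_k) (j : 'I_n) : (o i <= j < o i + p i)%N = (block j == i).
Proof.
apply/idP/eqP => [/andP[oj jo]|<-].
  have jp : (j - o i < p i)%N by rewrite ltn_subLR.
  have -> : j = tagnat.Rank i (Ordinal jp).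
    by apply: val_inj; rewrite [RHS]tagnat.RankEsum /= subnKC.
  by rewrite tagnat.Rank1K.
have jE : (j : nat) = (o (block j) + tagnat.sig2 j)%N.
  by rewrite -tagnat.RankEsum tagnat.sig2K.
by rewrite jE leq_addr ltn_add2l ltn_ord.
Qed.

(** The linear map underlying [block_incl (o i)]. *)
Definition block_emb (i : 'I_k) (v : 'cV[H]_(p i)) : 'cV[H]_n :=
  (\matrix_(a, b) (a == o i + b :> nat)%:R) *m v.

Lemma submxcol_block_emb (i : 'I_k) (v : 'cV[H]_(p i)) : submxcol (block_emb v) i = v.
Proof.
apply/matrixP => a j; rewrite ord1 !mxE (bigD1 a) //= mxE.
rewrite [X in X == _]tagnat.RankEsum eqxx mul1r big1 ?addr0 // => b ba.
rewrite mxE [X in X == _]tagnat.RankEsum eqn_add2l val_eqE eq_sym (negbTE ba).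
by rewrite mul0r.
Qed.

Lemma submxcol_block_emb_neq (i j : 'I_k) (v : 'cV[H]_(p i)) : j != i ->
  submxcol (block_emb v) j = 0.
Proof.
move=> ji; apply/matrixP => a c; rewrite ord1 !mxE big1 // => b _.
have E : (o i + b)%N = tagnat.Rank i b by rewrite tagnat.RankEsum.
by rewrite mxE [X in _ == X]E tagnat.eq_Rank (negbTE ji) mul0r.
Qed.

Lemma block_embZ (i : 'I_k) (v : 'cV[H]_(p i)) (a : H) :
  block_emb (v *m a%:M) = block_emb v *m a%:M.
Proof. by rewrite /block_emb mulmxA. Qed.

Lemma block_emb_neq0 (i : 'I_k) (v : 'cV[H]_(p i)) : v != 0 -> block_emb v != 0.
Proof.
apply: contra_neq => /(congr1 (fun w => submxcol w i)) /=.
by rewrite submxcol_block_emb submxcol0.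
Qed.

Lemma vec_block_split (i : 'I_k) (v : 'cV[H]_n) :
  v = block_emb (submxcol v i) + \sum_(j | block j != i) delta_mx j 0 *m (v j 0)%:M.
Proof.
rewrite {1}[v]vec_sum_delta (bigID (fun j => block j == i)) /=; congr (_ + _).
apply/mxcolP => l; have [->|li] := eqVneq l i.
  rewrite submxcol_block_emb submxcol_sum; apply/matrixP => a c; rewrite ord1 summxE.
  rewrite (bigD1 (tagnat.Rank i a)) /= ?tagnat.Rank1K //.
  rewrite -submxcol_mul scaler_mxE !mxE !eqxx mul1r [X in _ + X]big1 ?addr0 // => j /andP[_ ja].
  by rewrite -submxcol_mul scaler_mxE !mxE eq_sym (negbTE ja) mul0r.
rewrite submxcol_block_emb_neq // submxcol_sum [LHS]big1 // => j /eqP ji.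
apply/matrixP => a c; rewrite ord1 -submxcol_mul scaler_mxE !mxE.
case: eqP => [aj|_]; last by rewrite mul0r.
by move: li; rewrite -ji -aj tagnat.Rank1K eqxx.
Qed.

Lemma submxcol_delta_neq (i : 'I_k) (j : 'I_n) : block j != i ->
  submxcol (delta_mx j 0 : 'cV[H]_n) i = 0.
Proof.
move=> ji; apply/matrixP => a c; rewrite ord1 !mxE.
by case: eqP => [aj|//]; move: ji; rewrite -aj tagnat.Rank1K eqxx.
Qed.

Lemma right_subspace_submxcol (i : 'I_k) (W : set 'cV[H]_(p i)) : right_subspace W ->
  right_subspace [set v : 'cV[H]_n | W (submxcol v i)].
Proof.
move=> [W0 WD WZ]; split=> /= [|v w Wv Ww|v a Wv].
- by rewrite submxcol0.
- by rewrite submxcolD; exact: WD.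
- by rewrite -submxcol_mul; exact: WZ.
Qed.

(** The set difference is the copy of the projectivization of [W] inside block [i]. Joining the
    basis points of all other blocks frees every coordinate outside block [i] and leaves only the
    condition on the component there. *)
Lemma block_span (i : 'I_k) (W : set 'cV[H]_(p i)) (J : set nat) : right_subspace W ->
  (forall j : 'I_n, J j <-> block j != i) ->
  proj_span ((proj_span (e [set j | (o i <= j < o i + p i)%N]) `\`
      block_incl (o i) (~` projectivization W)) `|` e J) =
  projectivization [set v | W (submxcol v i)].
Proof.
move=> sW Jblock; have [W0 _ WZ] := sW.
have inclE (w : nzvec R n) (v : 'cV[H]_(p i)) : val w = block_emb v ->
    block_incl (o i) (~` projectivization W) (proj_pt w) <-> ~ W v.
  move=> wv; split=> [[u [x [Wu /proj_ptP[a a0 wx] xu]]]|Wv].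
    have {}xu : val x = block_emb (val u) := xu.
    move=> Wv; apply: Wu; apply/projectivizationP => //.
    have -> : val u = v *m (a^-1)%:M.
      have : block_emb v = block_emb (val u *m a%:M) by rewrite -wv wx xu block_embZ.
      move=> /(congr1 (fun w => submxcol w i)); rewrite /= !submxcol_block_emb => ->.
      by rewrite -mulmxA -scalar_mxM divqq // mulmx1.
    exact: WZ.
  have v0 : v != 0 by apply/eqP => v0; apply: Wv; rewrite v0.
  by exists (nzv v0), w; split=> //= Wp; apply: Wv; apply/(projectivizationP (nzv v0)).
apply/seteqP; split.
  apply: proj_span_sub; first exact: right_subspace_submxcol.
  move=> q [[Vq nq]|[j /= Jj <-]]; last first.
    apply/projectivization_std; first exact: right_subspace_submxcol.
    by rewrite /= submxcol_delta_neq //; apply/Jblock.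
  (* The vectors supported on block [i]: every point of the span of its basis points is represented
     by one. *)
  pose W3 := [set v : 'cV[H]_n | v = block_emb (submxcol v i)].
  have sW3 : right_subspace W3.
    split; rewrite /W3 /=.
    - by rewrite submxcol0 /block_emb mulmx0.
    - by move=> v w vE wE; rewrite submxcolD /block_emb mulmxDr -/(block_emb _) {1}vE {1}wE.
    - by move=> v a vE; rewrite -submxcol_mul block_embZ -vE.
  have : projectivization W3 q.
    move: Vq; apply: proj_span_sub => // x [j /=]; rewrite block_range => /eqP ji <-.
    apply/projectivization_std => //; rewrite /W3 /=.
    rewrite {1}(vec_block_split i (delta_mx j 0)) [X in _ + X]big1 ?addr0 // => l li.
    have lj : l != j by apply: contra_neq li => ->.
    by rewrite mxE (negbTE lj) raddf0 mulmx0.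
  move=> [v vE vq]; rewrite -vq in nq *; exists v => //=; apply: contrapT => Wv.
  by apply: nq; exact/(inclE v _ vE).
move=> _ [v Wv <-]; apply: proj_span_pt => W2 sW2 SW2; have [_ W2D W2Z] := sW2.
rewrite (vec_block_split i (val v)); apply: W2D; last first.
  apply: right_subspace_sum => // j ji; apply: W2Z.
  by apply/projectivization_std => //; apply: SW2; right; exists j => //; exact/Jblock.
(* A zero component is no projective point, hence the separate case. *)
have [->|v0] := eqVneq (submxcol (val v) i) 0.
  by rewrite /block_emb mulmx0; case: sW2.
apply/(projectivizationP (nzv (block_emb_neq0 v0))) => //; apply: SW2; left; split.
  apply: proj_span_pt => W4 sW4 SW4 /=.
  rewrite [block_emb _]vec_sum_delta; apply: right_subspace_sum => // j _.
  have [ji|ji] := boolP (block j == i).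
    case: (sW4) => _ _; apply; apply/projectivization_std => //; apply: SW4.
    by exists j => //=; rewrite block_range.
  have -> : block_emb (submxcol (val v) i) j 0 = 0.
    have := submxcol_block_emb_neq (submxcol (val v) i) ji.
    move=> /matrixP/(_ (tagnat.sig2 j) 0); by rewrite !mxE tagnat.sig2K.
  by rewrite raddf0 mulmx0; case: sW4.
by move=> /(inclE _ (submxcol (val v) i)); apply.
Qed.

End BlockSpans.

(** * Equicontinuity region of the block diagonal matrix *)

Section MainResult.
Variable R : realType.
Local Notation C := R[i].
Local Notation H := (quat R).

(** Forward and backward powers share [G], so the two excluded sets coincide. *)
Lemma equicontinuity_parabolic r (A A' : 'M[H]_r) q (G : 'cV[H]_r -> R) :
  A * A' = 1 -> A' * A = 1 -> growth A (poly_weight R q) G ->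
  growth A' (poly_weight R q) G -> (exists u, G u != 0) ->
  equicontinuity_region (cyclic_group (proj_map A)) = ~` projectivization (null_set G).
Proof. by move=> AA' A'A AG A'G Gu; rewrite (equicontinuity_cyclic AA' A'A AG A'G) // setUid. Qed.

Lemma scaled_mul (r : nat) (A A' : 'M[H]_r) (lam : C) : lam != 0 -> commutes_qcplx A' ->
  A * A' = 1 -> (qcplx lam *: A) * (qcplx lam^-1 *: A') = 1.
Proof.
move=> lam0 cA' AA'; rewrite -!mul_scalar_mx -![_ *m _]/(_ * _) cA'.
by rewrite mulrA -(mulrA _ A) AA' mulr1 -[LHS]scalar_mxM -rmorphM divff.
Qed.

Lemma equicontinuity_block_diag (k : nat) (m : 'I_k.+1 -> nat) (lambda : 'I_k.+1 -> C)
    (A : forall i : 'I_k.+1, 'M[H]_(m i)) :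
  (forall i j : 'I_k.+1, (i < j)%N -> `|lambda i| < `|lambda j|) ->
  (forall i, lambda i != 0) -> (forall i, parabolic_block (A i)) ->
  let n := (\sum_(i < k.+1) m i)%N in
  let o (i : 'I_k.+1) := (\sum_(l < k.+1 | (l < i)%N) m l)%N in
  let e (J : set nat) := [set std_pt R j | j in [set j : 'I_n | J j]] in
  let V i := proj_span (e [set j | (o i <= j < o i + m i)%N]) in
  let Eqc i :=
    V i `\` block_incl (o i) (equicontinuity_region (cyclic_group (proj_map (A i)))) in
  equicontinuity_region (cyclic_group (proj_map (\mxdiag_i (qcplx (lambda i) *: A i)))) =
    ~` (proj_span (Eqc ord0 `|` e [set j | (m ord0 <= j)%N])
        `|` proj_span (e [set j | (j < o ord_max)%N] `|` Eqc ord_max)).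
Proof.
move=> lamlt lam0 parA n o e V Eqc.
(* Turning existence into data allows [A'], [q] and [G] to be functions of the block index. *)
have data i : {A' : 'M[H]_(m i) & {q : nat & {G : 'cV[H]_(m i) -> R |
  [/\ A i * A' = 1 /\ A' * A i = 1, growth (A i) (poly_weight R q) G,
      growth A' (poly_weight R q) G, exists u, G u != 0 & commutes_qcplx (A i)]}}}.
  have /cid[A' /cid[q /cid[G AG]]] := parabolic_growth (parA i).
  by exists A', q, G.
pose A' i := projT1 (data i).
pose q i := projT1 (projT2 (data i)).
pose G i := sval (projT2 (projT2 (data i))).
have dataP i : [/\ A i * A' i = 1 /\ A' i * A i = 1, growth (A i) (poly_weight R (q i)) (G i),
      growth (A' i) (poly_weight R (q i)) (G i), exists u, G i u != 0 & commutes_qcplx (A i)].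
  exact: (svalP (projT2 (projT2 (data i)))).
have AA' i : A i * A' i = 1 by case: (dataP i) => -[].
have A'A i : A' i * A i = 1 by case: (dataP i) => -[].
have AG i : growth (A i) (poly_weight R (q i)) (G i) by case: (dataP i).
have A'G i : growth (A' i) (poly_weight R (q i)) (G i) by case: (dataP i).
have Gu i : exists u, G i u != 0 by case: (dataP i).
have cA i : commutes_qcplx (A i) by case: (dataP i).
have cA' i : commutes_qcplx (A' i) := commutes_qcplx_inv (AA' i) (A'A i) (cA i).
have qlt (i j : 'I_k.+1) : (i < j)%N -> qnorm (qcplx (lambda i)) < qnorm (qcplx (lambda j)).
  by move=> /lamlt; rewrite !normr_qnorm ltcR.
have lamV0 i : (lambda i)^-1 != 0 by rewrite invr_neq0.
have qpos i : 0 < qnorm (qcplx (lambda i)).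
  rewrite lt_neqAle qnorm_ge0 andbT eq_sym qnorm_eq0.
  by apply: contra_neq (lam0 i) => -[].
have top : forall i : 'I_k.+1, i != ord_max ->
    qnorm (qcplx (lambda i)) < qnorm (qcplx (lambda ord_max)).
  by move=> i im; apply: qlt; rewrite ltn_neqAle -ltnS ltn_ord andbT.
have bot : forall i : 'I_k.+1, i != ord0 ->
    qnorm (qcplx (lambda i)^-1) < qnorm (qcplx (lambda ord0)^-1).
  by move=> i i0; rewrite !qnorm_qcplxV // ltf_pV2 ?posrE //; apply: qlt; rewrite lt0n.
have gG := dominated_growth AG cA top (lam0 ord_max).
have g'G := dominated_growth A'G cA' bot (lamV0 ord0).
have gg' : \mxdiag_i (qcplx (lambda i) *: A i) * \mxdiag_i (qcplx (lambda i)^-1 *: A' i) = 1.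
  by apply: mxdiag_inv => i; exact: scaled_mul.
have g'g : \mxdiag_i (qcplx (lambda i)^-1 *: A' i) * \mxdiag_i (qcplx (lambda i) *: A i) = 1.
  by apply: mxdiag_inv => i; rewrite -{2}[lambda i]invrK; exact: scaled_mul.
have nz i : exists u : 'cV[H]_n, G i (submxcol u i) != 0.
  by have [u Gui] := Gu i; exists (block_emb u); rewrite submxcol_block_emb.
rewrite (equicontinuity_cyclic gg' g'g gG g'G (nz ord_max) (nz ord0)) setUC.
have EqA i : equicontinuity_region (cyclic_group (proj_map (A i))) =
    ~` projectivization (null_set (G i)).
  exact: equicontinuity_parabolic (AA' i) (A'A i) (AG i) (A'G i) (Gu i).
have sG i : right_subspace (null_set (G i)) := right_subspace_null (AG i).
(* The first block starts at 0 and the last one ends at [n], so one inequality on [j] says that [j]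
   lies outside the block. *)
have o0 : o ord0 = 0%N by rewrite /o big_pred0.
have omax : (o ord_max + m ord_max = n)%N.
  rewrite /n (bigD1 ord_max) //= addnC /o; congr (_ + _)%N; apply: eq_bigl => i.
  by rewrite ltn_neqAle -ltnS ltn_ord andbT.
rewrite [e _ `|` Eqc _]setUC /Eqc !EqA.
rewrite !(block_span (W := null_set (G _))) //.
- move=> j; rewrite -block_range -/(o ord_max) omax ltn_ord andbT -ltnNge /=.
  by [].
- by move=> j; rewrite -block_range -/(o ord0) o0 add0n /= -leqNgt.
Qed.

End MainResult.

Theorem theorem6p2 (R : realType) (n k : nat) (gamma : PSL R n.+1)
  (m : 'I_k.+1 -> nat) (hm : n.+1 = (\sum_(i < k.+1) m i)%N)
  (lambda : 'I_k.+1 -> R[i]) (A : forall i : 'I_k.+1, 'M[quat R]_(m i))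
  (g : SL R n.+1) :
  loxoparabolic gamma ->
  psl_class g = gamma ->
  castmx (hm, hm) (val g) = \mxdiag_(i < k.+1) (qcplx (lambda i) *: A i) ->
  (forall i j : 'I_k.+1, (i < j)%N -> `|lambda i| < `|lambda j|) ->
  (forall i, lambda i != 0) ->
  (forall i, parabolic_block (A i)) ->
  let o (i : 'I_k.+1) := (\sum_(l < k.+1 | (l < i)%N) m l)%N in
  let e (J : set nat) := [set std_pt R j | j in [set j : 'I_n.+1 | J j]] in
  let V i := proj_span (e [set j | (o i <= j < o i + m i)%N]) in
  let Eqc i :=
    V i `\` block_incl (o i) (equicontinuity_region (cyclic_group (proj_map (A i)))) in
  equicontinuity_region (cyclic_group (psl_map gamma)) =
    ~` (proj_span (Eqc ord0 `|` e [set j | (m ord0 <= j)%N])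
        `|` proj_span (e [set j | (j < o ord_max)%N] `|` Eqc ord_max)).
Proof.
move=> _ <- gE lamlt lam0 parA o e V Eqc.
(* The projective map does not depend on the lift, so the given block diagonal lift may be used. *)
rewrite psl_map_class; move: (val g) gE => M.
rewrite /Eqc /V /e {Eqc V e}.
(* With [n.+1] abstracted, the size equation can be substituted and [castmx] becomes the
   identity. *)
move: {gamma g} n.+1 hm M => N hN; subst N => M.
rewrite castmx_id => ->.
exact: equicontinuity_block_diag.
Qed.
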